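(* Let $\eta,\sigma\in\{1,-1\}$, let $N\ge0$ be an integer, let $\delta\in\mathbb{R}$, and let $\Omega,T\in\mathbb{C}^{2(N+1)\times2(N+1)}$ be constant matrices satisfying $$\Omega T+\sigma T\Omega^*=0,\qquad TT^*=-\sigma\eta I.$$ Let $C^+\in\mathbb{C}^{2(N+1)}$ and $\phi(x,m)=e^{\Omega m+\frac{\delta}{4}(\coth\Omega)\,x}\,C^+$ for $x\in\mathbb{R}$, $m\in\mathbb{Z}$. Define $$f=|\phi,\partial_x\phi,\dots,\partial_x^N\phi;\ T\phi^*_\sigma,T\partial_x\phi^*_\sigma,\dots,T\partial_x^N\phi^*_\sigma|,$$ $$g=2\,|\phi,\partial_x\phi,\dots,\partial_x^{N+1}\phi;\ T\phi^*_\sigma,T\partial_x\phi^*_\sigma,\dots,T\partial_x^{N-1}\phi^*_\sigma|,$$ and assume $f$ is nowhere zero on $\mathbb{R}\times\mathbb{Z}$. Then $$\chi=\frac gf,\qquad\varpi=\frac{\partial_xf}{f}$$ solve the complex local ($\sigma=1$) and nonlocal ($\sigma=-1$) semi-discrete sine-Gordon equation $$2(\partial_x\widehat\chi-\partial_x\chi)+(\widehat\chi+\chi)\big[2(\widehat\varpi-\varpi)-\delta\big]=0,\qquad \partial_x\varpi=\eta\,\chi\,\chi^*_\sigma .$$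
   Context: For a function $F=F(x,m)$, $x\in\mathbb{R}$, $m\in\mathbb{Z}$: $\widehat F=F(x,m+1)$ and $F_\sigma(x,m)=F(\sigma x,\sigma m)$. The asterisk denotes (entrywise) complex conjugation, without transposition; $\partial_x^j\phi^*_\sigma$ means the $j$-th $x$-derivative of the function $(x,m)\mapsto\phi(\sigma x,\sigma m)^*$. $|a_0,\dots,a_p;b_0,\dots,b_q|$ is the determinant of the matrix with the listed columns in this order (the $T$-block of $g$ has $N$ columns and is empty if $N=0$). $\coth\Omega=(e^{2\Omega}+I)(e^{2\Omega}-I)^{-1}$, where $e^{2\Omega}-I$ is assumed invertible. *)

(* Defs.v *)
From mathcomp Require Import all_boot all_order all_algebra.
From mathcomp Require Import complex.
From mathcomp Require Import boolp classical_sets reals topology normedtype.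
From mathcomp Require Import sequences derive.

Set Implicit Arguments.
Unset Strict Implicit.
Unset Printing Implicit Defensive.

Import Order.TTheory GRing.Theory Num.Theory.
Import numFieldNormedType.Exports.

Local Open Scope ring_scope.
Local Open Scope complex_scope.

(* R[i] carries no canonical normed-module structure over R, so limits of
   complex sequences and derivatives of complex functions of a real variable
   are taken on the real and imaginary parts. *)
Definition climn (R : realType) (u : nat -> R[i]) : R[i] :=
  limn (fun k => complex.Re (u k)) +i* limn (fun k => complex.Im (u k)).

Definition cderivable (R : realType) (h : R -> R[i]) (x : R) : Prop :=
  derivable (fun t => complex.Re (h t)) x 1 /\ derivable (fun t => complex.Im (h t)) x 1.

Definition cderive (R : realType) (h : R -> R[i]) (x : R) : R[i] :=
  derive1 (fun t => complex.Re (h t)) x +i* derive1 (fun t => complex.Im (h t)) x.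

Definition expmx (R : realType) (n : nat) (A : 'M[R[i]]_n) : 'M[R[i]]_n :=
  \matrix_(i, j) climn (fun k => (\sum_(l < k) (l`!%:R)^-1 *: A ^+ l) i j).

(* Meaningful only when expmx (2 *: A) - 1%:M is invertible. *)
Definition cothmx (R : realType) (n : nat) (A : 'M[R[i]]_n) : 'M[R[i]]_n :=
  (expmx (2 *: A) + 1%:M) *m invmx (expmx (2 *: A) - 1%:M).

Definition conjc_mx (R : realType) (p q : nat) (A : 'M[R[i]]_(p, q)) :
  'M[R[i]]_(p, q) := map_mx conjc A.

Definition hat (R : realType) (V : Type) (F : R -> int -> V) : R -> int -> V :=
  fun x m => F x (m + 1).

Definition scale_args (R : realType) (V : Type) (sigma : int)
  (F : R -> int -> V) : R -> int -> V :=
  fun x m => F (sigma%:~R * x) (sigma * m).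

Definition dx (R : realType) (F : R -> int -> R[i]) : R -> int -> R[i] :=
  fun x m => cderive (F ^~ m) x.

Definition dxv (R : realType) (n : nat) (F : R -> int -> 'cV[R[i]]_n) :
  R -> int -> 'cV[R[i]]_n :=
  fun x m => \col_i cderive (fun t => F t m i 0) x.

(* | a_0, ..., a_(p-1); b_0, ..., b_(n-p-1) |, for p <= n: there are p columns
   from a and n - p columns from b. *)
Definition block_det (R : realType) (n p : nat) (a b : nat -> 'cV[R[i]]_n) :
  R[i] :=
  \det (\matrix_(i < n, j < n) if (j < p)%N then a j i 0 else b (j - p)%N i 0).

Definition phi_sol (R : realType) (n : nat) (delta : R) (Omega : 'M[R[i]]_n)
  (C : 'cV[R[i]]_n) : R -> int -> 'cV[R[i]]_n :=
  fun x m => expmx (Omega *~ m + (delta / 4 * x)%:C *: cothmx Omega) *m C.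

Definition phi_col (R : realType) (n : nat) (delta : R) (Omega : 'M[R[i]]_n)
  (C : 'cV[R[i]]_n) (x : R) (m : int) (j : nat) : 'cV[R[i]]_n :=
  iter j (@dxv R n) (phi_sol delta Omega C) x m.

(* T applied to the j-th x-derivative of (x, m) |-> phi(sigma x, sigma m)^*. *)
Definition Tphi_col (R : realType) (n : nat) (sigma : int) (delta : R)
  (Omega T : 'M[R[i]]_n) (C : 'cV[R[i]]_n) (x : R) (m : int) (j : nat) :
  'cV[R[i]]_n :=
  T *m iter j (@dxv R n)
    (fun y k => conjc_mx (scale_args sigma (phi_sol delta Omega C) y k)) x m.

Definition f_sol (R : realType) (N : nat) (sigma : int) (delta : R)
  (Omega T : 'M[R[i]]_(2 * N.+1)) (C : 'cV[R[i]]_(2 * N.+1)) :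
  R -> int -> R[i] :=
  fun x m => block_det N.+1 (phi_col delta Omega C x m)
                            (Tphi_col sigma delta Omega T C x m).

Definition g_sol (R : realType) (N : nat) (sigma : int) (delta : R)
  (Omega T : 'M[R[i]]_(2 * N.+1)) (C : 'cV[R[i]]_(2 * N.+1)) :
  R -> int -> R[i] :=
  fun x m => 2 * block_det N.+2 (phi_col delta Omega C x m)
                                (Tphi_col sigma delta Omega T C x m).

(* Differentiability is part of being a solution, since cderive is total. *)
Definition semidiscrete_sine_gordon (R : realType) (eta sigma : int)
  (delta : R) (chi varpi : R -> int -> R[i]) : Prop :=
  forall (x : R) (m : int),
    [/\ cderivable (chi ^~ m) x,
        cderivable (varpi ^~ m) x,
        2 * (dx (hat chi) x m - dx chi x m)
          + (hat chi x m + chi x m)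
            * (2 * (hat varpi x m - varpi x m) - delta%:C) = 0
      & dx varpi x m = eta%:~R * chi x m * conjc (scale_args sigma chi x m)].

(* Main.v *)
(* Let K = (delta / 4) coth Omega, so that phi_x = K phi, and psi := T phi^*_sigma
   satisfies psi_x = - K psi.  Since f <> 0, the columns of f form a basis, so
   there are unique polynomial relations P(K) phi + Q(K) psi = 0 (P monic of
   degree N + 1, deg Q <= N) and R(K) phi + S(K) psi = 0 (deg R <= N, S monic of
   degree N + 1).  With p, q, r, s the coefficients of degree N, Cramer's rule
   gives chi = - 2 q and varpi = s - p, while p + s = - tr K is constant.
   Differentiating the relation (P, Q) in x, shifting it in m, or conjugating it
   yields new relations of small degree, and uniqueness turns these into
   identities between coefficients: p_x = - 2 q r, the lattice equation for q,
   and r = eta q^*_sigma. *)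
Require Import Defs.
From mathcomp Require Import all_boot all_order all_algebra.
From mathcomp Require Import complex ring.
From mathcomp Require Import boolp classical_sets functions reals topology.
From mathcomp Require Import normedtype sequences derive realfun exp.

Set Implicit Arguments.
Unset Strict Implicit.
Unset Printing Implicit Defensive.

Import Order.TTheory GRing.Theory Num.Theory.
Import numFieldNormedType.Exports.
Import Normc.

Local Open Scope ring_scope.
Local Open Scope complex_scope.

(** The hyperbolic cotangent is what makes the lattice shift algebraic. With [U = expmx Omega] and
    [kappa = delta / 4], the definition of [K] amounts to [(K - kappa) U^2 = K + kappa]. Since [phi]
    is shifted by [U] and [psi] by its inverse, multiplying the relation at [m + 1] by
    [(K - kappa) U] leaves polynomials in [K] applied to [phi] and [psi] at [m]. The matrix [T]
    turns the conjugate of [K] into [- sigma K], and [T T^* = - sigma eta] sends the conjugate of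
    [psi] back to a multiple of [phi]; so conjugation exchanges the two relations, and [eta] enters
    there. Each new relation is compared with a combination of old ones chosen to cancel all
    coefficients above degree [N]; the rest vanishes by independence. The coefficient of degree
    [N - 1] of [Q] occurs both in the [x]-derivative and in the shift, and cancels in the lattice
    equation. On the analytic side [expmx] is merely an entrywise limit, so its derivative along a
    real line, its addition law and its behaviour under conjugation have to be derived. *)

(** * Polynomial relations between [phi] and [psi], and their uniqueness *)

Section Relations.
Variables (F : fieldType) (n N : nat).
Hypothesis n_def : n.+1 = (2 * N.+1)%N.
Variable (K : 'M[F]_n.+1).
Implicit Types (phi psi : 'cV[F]_n.+1) (P Q R S dP dQ : {poly F}).

Definition polyrel phi psi P Q : 'cV[F]_n.+1 :=
  horner_mx K P *m phi + horner_mx K Q *m psi.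

Lemma polyrelD phi psi P Q P' Q' :
  polyrel phi psi (P + P') (Q + Q') =
  polyrel phi psi P Q + polyrel phi psi P' Q'.
Proof. by rewrite /polyrel !rmorphD /= !mulmxDl addrACA. Qed.

Lemma polyrelM phi psi A P Q :
  polyrel phi psi (A * P) (A * Q) = horner_mx K A *m polyrel phi psi P Q.
Proof. by rewrite /polyrel !rmorphM /= -!mulmxE -!mulmxA mulmxDr. Qed.

Lemma polyrelN phi psi P Q :
  polyrel phi psi (- P) (- Q) = - polyrel phi psi P Q.
Proof. by rewrite /polyrel !rmorphN /= !mulNmx opprD. Qed.

(** Because [phi_x = K phi] and [psi_x = - K psi], differentiating only the vectors in the relation
    [('X^d - P, - Q)] multiplies its components by ['X] and [- 'X]. *)
Lemma polyrel_mulX phi psi P Q d :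
  polyrel phi psi ('X * ('X^d - P)) (- ('X * (- Q))) =
  K ^+ d *m (K *m phi) - polyrel (K *m phi) (- K *m psi) P Q.
Proof.
have hX A : horner_mx K ('X * A) = horner_mx K A *m K.
  by rewrite mulrC rmorphM /= horner_mx_X.
rewrite mulrN opprK /polyrel !hX rmorphB rmorphXn /= horner_mx_X !mulmxBl.
by rewrite mulNmx mulmxN opprD opprK !mulmxA addrA.
Qed.

(** Multiply the relation for [phi1], [psi1] by [(K - kappa) U]: the [phi] term acquires
    [(K - kappa) U^2 = K + kappa], while in the [psi] term [U] is absorbed by [U psi1 = psi]. *)
Lemma polyrel_shift phi psi phi1 psi1 U kappa P Q : U *m K = K *m U ->
  (K - kappa%:M) *m (U *m U) = K + kappa%:M ->
  phi1 = U *m phi -> U *m psi1 = psi -> polyrel phi1 psi1 P Q = 0 ->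
  polyrel phi psi (('X + kappa%:P) * P) (('X - kappa%:P) * Q) = 0.
Proof.
move=> UK KU -> <- rel.
have comU A : U *m horner_mx K A = horner_mx K A *m U by exact: comm_mx_horner.
have hXc c A : horner_mx K (('X + c%:P) * A) = horner_mx K A *m (K + c%:M).
  by rewrite mulrC rmorphM rmorphD /= horner_mx_X horner_mx_C.
have KA A : (K - kappa%:M) *m horner_mx K A = horner_mx K A *m (K - kappa%:M).
  rewrite mulmxBl mulmxBr scalar_mxC; congr (_ - _).
  by rewrite comm_mx_horner.
transitivity ((K - kappa%:M) *m (U *m polyrel (U *m phi) psi1 P Q)).
  rewrite /polyrel -polyCN !hXc -KU rmorphN /= !mulmxDr !(mulmxA U) !comU.
  by rewrite !mulmxA !KA -mulmxDr.
by rewrite rel !mulmx0.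
Qed.

(** The matrix behind [f]: powers of [K] and of [- K] stand for the [x]-derivatives of [phi] and
    [psi], so that everything takes place over an arbitrary field. *)
Definition wronskmx phi psi : 'M[F]_n.+1 :=
  \matrix_(i, j) if (j < N.+1)%N then (K ^+ j *m phi) i 0
                 else ((- K) ^+ (j - N.+1) *m psi) i 0.

Definition lowpoly (c : 'cV[F]_n.+1) : {poly F} :=
  \poly_(j < N.+1) c (inord j) 0.

(* The columns of wronskmx coming from psi are (- K)^j psi. *)
Definition highpoly (c : 'cV[F]_n.+1) : {poly F} :=
  \poly_(j < N.+1) ((-1) ^+ j * c (inord (N.+1 + j)) 0).

(** The dictionary between coordinates in the basis of columns and pairs of polynomials of degree at
    most [N]; existence and uniqueness of the relations both come from it. *)
Lemma wronskmx_mul phi psi c :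
  wronskmx phi psi *m c = polyrel phi psi (lowpoly c) (highpoly c).
Proof.
apply/matrixP => i k; rewrite ord1 {k} /polyrel [LHS]mxE [RHS]mxE.
pose G (j : nat) := (if (j < N.+1)%N then (K ^+ j *m phi) i 0
                 else ((- K) ^+ (j - N.+1) *m psi) i 0) * c (inord j) 0.
transitivity (\sum_(j < n.+1) G j).
  by apply: eq_bigr => j _; rewrite [wronskmx _ _ _ _]mxE /G inord_val.
have hp (d : nat -> F) (u : 'cV[F]_n.+1) :
    (horner_mx K (\poly_(j < N.+1) d j) *m u) i 0 =
    \sum_(j < N.+1) (K ^+ j *m u) i 0 * d j.
  rewrite poly_def rmorph_sum /= mulmx_suml summxE; apply: eq_bigr => j _.
  by rewrite linearZ /= rmorphXn /= horner_mx_X -scalemxAl mxE mulrC.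
have le_Nn : (N.+1 <= n.+1)%N by rewrite n_def leq_pmull.
rewrite !hp -(big_mkord xpredT G) (big_cat_nat _ le_Nn) //=; congr (_ + _).
  by rewrite big_mkord; apply: eq_bigr => j _; rewrite /G ltn_ord.
have -> : \sum_(N.+1 <= j < n.+1) G j = \sum_(j < N.+1) G (j + N.+1)%N.
  by rewrite -{1}[N.+1]add0n big_addn {1}n_def mul2n -addnn addnK big_mkord.
apply: eq_bigr => j _; rewrite /G addnK ltnNge leq_addl /= addnC.
rewrite -scaleN1r exprZn -scalemxAl mxE.
by rewrite !mulrA; congr (_ * _); rewrite mulrC.
Qed.

Lemma size_lowpoly c : (size (lowpoly c) <= N.+1)%N.
Proof. exact: size_poly. Qed.

Lemma size_highpoly c : (size (highpoly c) <= N.+1)%N.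
Proof. exact: size_poly. Qed.

Lemma polyrel_low phi psi c : wronskmx phi psi *m c = K ^+ N.+1 *m phi ->
  polyrel phi psi ('X^(N.+1) - lowpoly c) (- highpoly c) = 0.
Proof.
move=> Wc; rewrite -[- highpoly c]add0r polyrelD polyrelN -wronskmx_mul Wc.
by rewrite /polyrel rmorph0 mul0mx addr0 rmorphXn /= horner_mx_X subrr.
Qed.

(** The factor [(-1) ^+ N] turns the leading term [- (- K) ^+ N.+1] into [K ^+ N.+1], which makes
    the second component monic. *)
Lemma polyrel_high phi psi c : wronskmx phi psi *m c = (- K) ^+ N.+1 *m psi ->
  polyrel phi psi (((-1) ^+ N)%:P * lowpoly c)
                  ('X^(N.+1) + ((-1) ^+ N)%:P * highpoly c) = 0.
Proof.
move=> Wc; rewrite -[_ * lowpoly c]add0r polyrelD polyrelM -wronskmx_mul Wc.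
rewrite /polyrel rmorph0 mul0mx add0r rmorphXn /= horner_mx_X horner_mx_C.
rewrite mul_scalar_mx -scaleN1r exprZn -scalemxAl scalerA -exprD addnS.
by rewrite -signr_odd /= oddD addbb scaleN1r subrr.
Qed.

Definition relindep phi psi := forall P Q, (size P <= N.+1)%N ->
  (size Q <= N.+1)%N -> polyrel phi psi P Q = 0 -> P = 0 /\ Q = 0.

Lemma wronskmx_relindep phi psi :
  wronskmx phi psi \in unitmx -> relindep phi psi.
Proof.
move=> Wu P Q sP sQ.
(* The signs on the coefficients of [Q] undo those in [highpoly], so the given relation says that
   the invertible matrix kills [c]. *)
pose c : 'cV[F]_n.+1 := \col_j (if (j < N.+1)%N then P`_j
                                else (-1) ^+ (j - N.+1) * Q`_(j - N.+1)).
have ltN j : (j < N.+1)%N -> (N.+1 + j < n.+1)%N.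
  by move=> jN; rewrite n_def mul2n -addnn ltn_add2l.
have <- : lowpoly c = P.
  apply/polyP => j; rewrite coef_poly; case: ltnP => jN; last first.
    by rewrite nth_default // (leq_trans sP).
  rewrite mxE inordK ?jN // (leq_trans jN) // n_def leq_pmull //.
have <- : highpoly c = Q.
  apply/polyP => j; rewrite coef_poly; case: ltnP => jN; last first.
    by rewrite nth_default // (leq_trans sQ).
  rewrite mxE inordK ?ltN // ltnNge leq_addr /= addKn mulrA -exprMn.
  by rewrite mulrN1 opprK expr1n mul1r.
rewrite -wronskmx_mul => Wc.
have -> : c = 0 by rewrite -(mulKmx Wu c) Wc mulmx0.
by split; apply/polyP => j; rewrite coef_poly coef0 !mxE ?mulr0 if_same.
Qed.

Lemma size_coef_le d (A : {poly F}) :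
  (size A <= d.+1)%N -> A`_d = 0 -> (size A <= d)%N.
Proof.
move=> sA A0; apply/leq_sizeP => j; rewrite leq_eqVlt => /predU1P[<-//|].
by move=> dj; rewrite nth_default // (leq_trans sA).
Qed.

Lemma size_polyB_le d (A B : {poly F}) :
  (size A <= d)%N -> (size B <= d)%N -> (size (A - B)%R <= d)%N.
Proof.
by move=> sA sB; rewrite (leq_trans (size_polyD _ _)) // geq_max size_polyN sA.
Qed.

Lemma size_polyZ_le d c (A : {poly F}) :
  (size A <= d)%N -> (size (c *: A)%R <= d)%N.
Proof. exact/leq_trans/size_scale_leq. Qed.

(** Monic of degree [d] is encoded throughout as the bound [size (S - 'X^d) <= d]; this recovers the
    usual form. *)
Lemma subXn_size d (S : {poly F}) : (size (S - 'X^d)%R <= d)%N ->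
  S`_d = 1 /\ (size S <= d.+1)%N.
Proof.
move=> sS; split.
  have /polyP/(_ d) := subrK ('X^d) S.
  by rewrite coefD coefXn eqxx [X in X + _]nth_default // add0r => <-.
rewrite -(subrK 'X^d S) (leq_trans (size_polyD _ _)) // size_polyXn.
by rewrite geq_max leqnn (leq_trans sS).
Qed.

Lemma relindep_x phi psi P Q R S dP dQ : relindep phi psi ->
  (size dP <= N.+1)%N -> (size dQ <= N.+1)%N ->
  (size Q <= N.+1)%N -> (size R <= N.+1)%N ->
  (size (S - 'X^(N.+1))%R <= N.+1)%N ->
  polyrel phi psi R S = 0 ->
  polyrel phi psi dP dQ + polyrel phi psi ('X * P) (- ('X * Q)) = 0 ->
  polyrel phi psi P Q = 0 ->
  dP`_N = - 2 * Q`_N * R`_N /\ dQ`_N = ('X * Q)`_N *+ 2 - 2 * Q`_N * S`_N.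
Proof.
move=> ind sdP sdQ sQ sR sS relR reld relP.
set q := Q`_N.
have [S1 sS'] := subXn_size sS.
(* Subtracting ['X] times [(P, Q)] from the derivative removes ['X * P] and leaves [- 2 q] in degree
   [N + 1] of the second component; adding [2 q] times the relation with monic [S] cancels it. *)
have [] : dP + (2 * q) *: R = 0 /\ dQ - 'X * Q *+ 2 + (2 * q) *: S = 0.
  apply: ind.
  - rewrite (leq_trans (size_polyD _ _)) // geq_max sdP.
    by rewrite (leq_trans (size_scale_leq _ _)).
  - apply: size_coef_le.
      rewrite (leq_trans (size_polyD _ _)) // geq_max.
      rewrite (leq_trans (size_scale_leq _ _)) // andbT.
      rewrite (leq_trans (size_polyD _ _)) // geq_max (leq_trans sdQ) //=.
      rewrite size_polyN -scaler_nat (leq_trans (size_scale_leq _ _)) //.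
      by rewrite (leq_trans (size_polyMleq _ _)) // size_polyX.
    rewrite coefD coefB coefZ S1 [dQ`__]nth_default // coefMn coefXM /= -/q.
    by ring.
  - have -> : dP + (2 * q) *: R =
        (dP + ('X * P)) + (- ('X * P) + (2 * q) *: R) by ring.
    have -> : dQ - 'X * Q *+ 2 + (2 * q) *: S =
        (dQ - 'X * Q) + (- ('X * Q) + (2 * q) *: S) by ring.
    rewrite polyrelD (polyrelD _ _ dP) reld add0r polyrelD polyrelN polyrelM.
    by rewrite relP mulmx0 oppr0 -!mul_polyC polyrelM relR mulmx0 addr0.
move=> /polyP/(_ N) + /polyP/(_ N).
rewrite !coefD coefN !coefZ coefMn !coef0 => eP eQ.
move/eqP: eP; rewrite addr_eq0 => /eqP->.
by move/eqP: eQ; rewrite -addrA addr_eq0 => /eqP->; split; ring.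
Qed.

(** The shifted relation must equal [('X + alpha)] times [(P, Q)] plus [Q1]_N - Q[_N] times
    [(R, S)]; the conclusion is the coefficient of degree [N] in the second component. *)
Lemma relindep_shift phi psi kappa P Q R S P1 Q1 : relindep phi psi ->
  (size (P - 'X^(N.+1))%R <= N.+1)%N -> (size Q <= N.+1)%N ->
  (size R <= N.+1)%N -> (size (S - 'X^(N.+1))%R <= N.+1)%N ->
  (size (P1 - 'X^(N.+1))%R <= N.+1)%N -> (size Q1 <= N.+1)%N ->
  polyrel phi psi P Q = 0 -> polyrel phi psi R S = 0 ->
  polyrel phi psi (('X + kappa%:P) * P1) (('X - kappa%:P) * Q1) = 0 ->
  ('X * Q1)`_N - kappa * Q1`_N =
  ('X * Q)`_N + (P1`_N - P`_N + kappa) * Q`_N + (Q1`_N - Q`_N) * S`_N.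
Proof.
move=> ind sP sQ sR sS sP1 sQ1 relP relR rel1.
have [P_N1 sP'] := subXn_size sP; have [P1_N1 sP1'] := subXn_size sP1.
have [S_N1 sS'] := subXn_size sS.
(* Degree [N + 2] of the first component cancels by monicity; [alpha] is the constant that cancels
   degree [N + 1]. *)
set alpha := P1`_N - _ + _.
have sXa b (A : {poly F}) d :
    (size A <= d)%N -> (size (('X + b%:P) * A)%R <= d.+1)%N.
  move=> sA; rewrite (leq_trans (size_polyMleq _ _)) //.
  by rewrite size_XaddC.
have [] : ('X + kappa%:P) * P1 - ('X + alpha%:P) * P
            - (Q1`_N - Q`_N)%:P * R = 0 /\
          ('X - kappa%:P) * Q1 - ('X + alpha%:P) * Q
            - (Q1`_N - Q`_N)%:P * S = 0.
  apply: ind.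
  - apply: size_coef_le; last first.
      rewrite !coefB coefCM !mulrDl !coefD !coefXM !coefCM /= P1_N1 P_N1.
      by rewrite [R`__]nth_default // /alpha; ring.
    apply: size_coef_le; last first.
      rewrite !coefB coefCM !mulrDl !coefD !coefXM !coefCM /= P1_N1 P_N1.
      rewrite [R`__]nth_default ?(leqW sR) // [P1`__]nth_default //.
      by rewrite [P`__]nth_default //; ring.
    rewrite mul_polyC; apply: size_polyB_le; last exact/size_polyZ_le/leqW/leqW.
    by apply: size_polyB_le; apply: sXa.
  - apply: size_coef_le; last first.
      rewrite !coefB coefCM mulrBl mulrDl coefB coefD !coefXM !coefCM /= S_N1.
      by rewrite [Q`_N.+1]nth_default ?[Q1`_N.+1]nth_default //; ring.
    rewrite mul_polyC -polyCN; apply: size_polyB_le.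
      by apply: size_polyB_le; apply: sXa.
    exact: size_polyZ_le.
  - rewrite !polyrelD !polyrelN rel1 !polyrelM relP relR !mulmx0.
    by rewrite oppr0 !addr0.
move=> _ /polyP/(_ N); rewrite !coefB coefCM mulrBl mulrDl coefB coefD !coefCM.
rewrite coef0 => /eqP; rewrite -addrA -opprD subr_eq0 => /eqP ->.
by [].
Qed.

Lemma relindep_uniq phi psi R S R' S' : relindep phi psi ->
  (size R <= N.+1)%N -> (size (S - 'X^(N.+1))%R <= N.+1)%N ->
  (size R' <= N.+1)%N -> (size (S' - 'X^(N.+1))%R <= N.+1)%N ->
  polyrel phi psi R S = 0 -> polyrel phi psi R' S' = 0 -> R = R'.
Proof.
move=> ind sR sS sR' sS' rel rel'.
have [] : R - R' = 0 /\ S - S' = 0; last by move/eqP; rewrite subr_eq0 => /eqP.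
apply: ind; last by rewrite polyrelD polyrelN rel rel' subrr.
  exact: size_polyB_le.
have -> : S - S' = (S - 'X^(N.+1)) - (S' - 'X^(N.+1)) by ring.
exact: size_polyB_le.
Qed.

End Relations.

(** * Traces expressed by coordinates in the basis of columns *)

Lemma col_mulmx (F : fieldType) m n p (j : 'I_p) (A : 'M[F]_(m, n)) B :
  col j (A *m B) = A *m col j B.
Proof. by rewrite !colE mulmxA. Qed.

Section Traces.
Variables (F : fieldType) (n N : nat).
Hypothesis n_def : n.+1 = (2 * N.+1)%N.
Variable (K : 'M[F]_n.+1).
Implicit Types (phi psi : 'cV[F]_n.+1).

Let n_half : n = (N + N.+1)%N.
Proof. by apply: succn_inj; rewrite n_def mul2n -addnn addSn. Qed.

(** If column [j] of [D] is a multiple of column [j + 1] of the matrix, its coordinate vector is a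
    multiple of the basis vector [j + 1] and adds nothing to the diagonal. Only the last column of
    each block, [N] and [n], contributes. *)
Lemma wronskmx_trace phi psi (D : 'M[F]_n.+1) u1 u2 :
  wronskmx N K phi psi \in unitmx ->
  (forall j : 'I_n.+1, j != N :> nat -> j != n :> nat ->
     exists c, col j D = c *: col (inord j.+1) (wronskmx N K phi psi)) ->
  col (inord N) D = u1 -> col ord_max D = u2 ->
  \tr (invmx (wronskmx N K phi psi) *m D) =
  (invmx (wronskmx N K phi psi) *m u1) (inord N) 0 +
  (invmx (wronskmx N K phi psi) *m u2) ord_max 0.
Proof.
move=> Wu Dcol <- <-; set W := wronskmx _ _ _ _ in Wu Dcol *.
have ltNn : (N < n)%N by rewrite n_half leq_addl.
have NE : (inord N : 'I_n.+1) = N :> nat by rewrite inordK // ltnW.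
have entryE j : (invmx W *m D) j j = (invmx W *m col j D) j 0.
  by rewrite -col_mulmx [RHS]mxE.
rewrite /mxtrace (bigD1 (inord N)) //= (bigD1 ord_max) //=; last first.
  by rewrite -val_eqE /= NE gtn_eqF.
rewrite !entryE big1 ?addr0 // => j /andP[jN jmax].
have jN' : j != N :> nat by rewrite -NE val_eqE.
have [c cE] := Dcol j jN' jmax.
rewrite entryE cE -scalemxAr -col_mulmx mulVmx // !mxE -val_eqE /= inordK.
  by rewrite ltn_eqF // mulr0.
by rewrite ltnS ltn_neqAle jmax -ltnS ltn_ord.
Qed.

(** Conjugating [K] by the matrix of columns preserves the trace. Multiplication by [K] moves each
    column to the next, with a minus sign in the [psi] block: hence the difference. *)
Lemma wronskmx_tr phi psi : wronskmx N K phi psi \in unitmx ->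
  \tr K =
  (invmx (wronskmx N K phi psi) *m (K ^+ N.+1 *m phi)) (inord N) 0 -
  (invmx (wronskmx N K phi psi) *m ((- K) ^+ N.+1 *m psi)) ord_max 0.
Proof.
move=> Wu; set W := wronskmx _ _ _ _.
have ltNn : (N < n)%N by rewrite n_half leq_addl.
have colW (j : 'I_n.+1) : col j W = if (j < N.+1)%N then K ^+ j *m phi
    else (- K) ^+ (j - N.+1) *m psi.
  by apply/matrixP => i k; rewrite ord1 mxE mxE; case: ifP.
transitivity (\tr (invmx W *m (K *m W))).
  by rewrite mxtrace_mulC mulmxK.
rewrite (wronskmx_trace Wu (u1 := K ^+ N.+1 *m phi)
   (u2 := - ((- K) ^+ N.+1 *m psi))).
- by rewrite mulmxN [(- _ : 'M_(_, _)) _ _]mxE.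
- move=> j jN jn; have jltn : (j.+1 < n.+1)%N.
    by rewrite ltnS ltn_neqAle jn -ltnS ltn_ord.
  have [jltN|Nltj|/eqP] := ltngtP j N; last by rewrite (negbTE jN).
    exists 1; rewrite col_mulmx !colW inordK // !ltnS jltN ltnW //.
    by rewrite scale1r exprS mulmxA.
  exists (- 1); rewrite col_mulmx !colW inordK // !(ltnNge _ N.+1) Nltj /=.
  rewrite (leqW Nltj) /= subSn // exprS scaleN1r mulmxA -mulmxE.
  by rewrite !mulNmx opprK.
- by rewrite col_mulmx colW (inordK (leqW ltNn)) ltnSn exprS mulmxA.
- rewrite col_mulmx colW /= ltnNge ltNn /= exprS -mulmxE mulNmx.
  have -> : (n - N.+1 = N)%N by rewrite n_half addnK.
  by rewrite mulNmx opprK mulmxA.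
Qed.

(** The left side is the logarithmic derivative of the determinant. Differentiation moves columns to
    the next one with sign [+] in both blocks, hence a sum here. *)
Lemma wronskmx_tr_dx phi psi : wronskmx N K phi psi \in unitmx ->
  \tr (invmx (wronskmx N K phi psi) *m wronskmx N K (K *m phi) (- K *m psi)) =
  (invmx (wronskmx N K phi psi) *m (K ^+ N.+1 *m phi)) (inord N) 0 +
  (invmx (wronskmx N K phi psi) *m ((- K) ^+ N.+1 *m psi)) ord_max 0.
Proof.
move=> Wu; set W := wronskmx _ _ _ _.
have ltNn : (N < n)%N by rewrite n_half leq_addl.
have colW phi1 psi1 (j : 'I_n.+1) : col j (wronskmx N K phi1 psi1) =
    if (j < N.+1)%N then K ^+ j *m phi1 else (- K) ^+ (j - N.+1) *m psi1.
  by apply/matrixP => i k; rewrite ord1 mxE mxE; case: ifP.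
apply: wronskmx_trace => //.
- move=> j jN jn; have jltn : (j.+1 < n.+1)%N.
    by rewrite ltnS ltn_neqAle jn -ltnS ltn_ord.
  exists 1; rewrite scale1r !colW inordK // !ltnS.
  have [jltN|Nltj|/eqP] := ltngtP j N; last by rewrite (negbTE jN).
    by rewrite exprSr mulmxA.
  by rewrite subSn // exprSr mulmxA.
- by rewrite colW (inordK (leqW ltNn)) ltnSn exprSr mulmxA.
- rewrite colW /= ltnNge ltNn /= mulmxA mulmxE -exprSr.
  by have -> : (n - N.+1 = N)%N by rewrite n_half addnK.
Qed.

End Traces.

(** * Cramer's rule for trading a [b] column for an [a] column *)

Section BlockDeterminant.
Variables (F : fieldType) (n : nat).
Implicit Types a b : nat -> 'cV[F]_n.+1.

Definition blockmx p a b : 'M[F]_n.+1 :=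
  \matrix_(i, j) if (j < p)%N then a j i 0 else b (j - p)%N i 0.

(** The entry of the adjugate product is the determinant with the last column replaced by [a p];
    carrying that column back to position [p] crosses [n - p] columns. *)
Lemma det_blockmxS p a b : (p <= n)%N -> \det (blockmx p.+1 a b) =
  (-1) ^+ (p + n) * (\adj (blockmx p a b) *m a p) ord_max 0.
Proof.
move=> pn; rewrite (expand_det_col _ (inord p)) mxE mulr_sumr.
apply: eq_bigr => i _; rewrite !mxE inordK // ltnSn /cofactor inordK //=.
rewrite mulrC [RHS]mulrA [in RHS]mulrA -exprD; congr (_ * _ * _).
  rewrite -signr_odd -[RHS]signr_odd !oddD.
  by case: (odd i); case: (odd p); case: (odd n).
congr (\det _); apply/matrixP => k l; rewrite !mxE /= inordK // /bump.
rewrite [(n <= l)%N]leqNgt ltn_ord add0n.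
by case: (ltnP l p) => pl; rewrite ?add1n ?add0n ltnS ?(leq_gtF pl) // ltnW.
Qed.

End BlockDeterminant.

(** * Calculus for complex and matrix functions of a real variable *)

Section ComplexDerivative.
Variable R : realType.
Implicit Types (h g : R -> R[i]) (x : R) (l : R[i]).

Definition is_cderive h x l :=
  is_derive x 1 (fun t => complex.Re (h t)) (complex.Re l) /\
  is_derive x 1 (fun t => complex.Im (h t)) (complex.Im l).

Lemma is_cderive_cderivable h x l : is_cderive h x l -> cderivable h x.
Proof. by move=> [[? _] [? _]]; split. Qed.

Lemma is_cderive_cderive h x l : is_cderive h x l -> cderive h x = l.
Proof.
by case: l => a b [/= da db]; rewrite /cderive !derive1E !derive_val.
Qed.

Lemma is_cderive_cst l x : is_cderive (fun _ => l) x 0.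
Proof. by split; apply: is_derive_cst. Qed.

Lemma Re_add (a b : R[i]) : complex.Re (a + b) = complex.Re a + complex.Re b.
Proof. by case: a b => [? ?] [? ?]. Qed.

Lemma Im_add (a b : R[i]) : complex.Im (a + b) = complex.Im a + complex.Im b.
Proof. by case: a b => [? ?] [? ?]. Qed.

Lemma Re_mul (a b : R[i]) : complex.Re (a * b) =
  complex.Re a * complex.Re b - complex.Im a * complex.Im b.
Proof. by case: a b => [? ?] [? ?]. Qed.

Lemma Im_mul (a b : R[i]) : complex.Im (a * b) =
  complex.Re a * complex.Im b + complex.Im a * complex.Re b.
Proof. by case: a b => [? ?] [? ?]. Qed.

Lemma Re_conj (a : R[i]) : complex.Re a^* = complex.Re a.
Proof. by case: a. Qed.

Lemma Im_conj (a : R[i]) : complex.Im a^* = - complex.Im a.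
Proof. by case: a. Qed.

Lemma is_cderiveD h g x l k : is_cderive h x l -> is_cderive g x k ->
  is_cderive (fun t => h t + g t) x (l + k).
Proof.
move=> [h1 h2] [g1 g2]; split.
  by rewrite Re_add; under eq_fun do rewrite Re_add; apply: is_deriveD.
by rewrite Im_add; under eq_fun do rewrite Im_add; apply: is_deriveD.
Qed.

Lemma is_cderiveM h g x l k : is_cderive h x l -> is_cderive g x k ->
  is_cderive (fun t => h t * g t) x (l * g x + h x * k).
Proof.
move=> [h1 h2] [g1 g2]; split.
  under eq_fun do rewrite Re_mul.
  apply: is_derive_eq (is_deriveB (is_deriveM h1 g1) (is_deriveM h2 g2)) _.
  by rewrite Re_add !Re_mul /GRing.scale /=; ring.
under eq_fun do rewrite Im_mul.
apply: is_derive_eq (is_deriveD (is_deriveM h1 g2) (is_deriveM h2 g1)) _.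
by rewrite Im_add !Im_mul /GRing.scale /=; ring.
Qed.

Lemma is_cderive_eq h x l k : is_cderive h x l -> l = k -> is_cderive h x k.
Proof. by move=> ? <-. Qed.

Lemma is_cderiveZ c h x l : is_cderive h x l ->
  is_cderive (fun t => c * h t) x (c * l).
Proof.
move=> dh; apply: is_cderive_eq (is_cderiveM (is_cderive_cst c x) dh) _.
by rewrite mul0r add0r.
Qed.

Lemma is_cderiveN h x l :
  is_cderive h x l -> is_cderive (fun t => - h t) x (- l).
Proof.
move=> dh; rewrite -mulN1r (_ : (fun _ => _) = fun t => -1 * h t).
  exact: is_cderiveZ.
by apply/funext => t; rewrite mulN1r.
Qed.

Lemma is_cderive_sum (I : Type) (r : seq I) (P : pred I)
    (h : I -> R -> R[i]) x (l : I -> R[i]) :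
  (forall i, is_cderive (h i) x (l i)) ->
  is_cderive (fun t => \sum_(i <- r | P i) h i t) x (\sum_(i <- r | P i) l i).
Proof.
move=> dh; elim: r => [|i r IH].
  by rewrite big_nil; under eq_fun do rewrite big_nil; apply: is_cderive_cst.
rewrite big_cons; under eq_fun do rewrite big_cons.
by case: ifP => // _; apply: is_cderiveD.
Qed.

Lemma is_cderive_prod n (h : 'I_n -> R -> R[i]) x (l : 'I_n -> R[i]) :
  (forall i, is_cderive (h i) x (l i)) ->
  is_cderive (fun t => \prod_i h i t) x
    (\sum_i \prod_j (if j == i then l j else h j x)).
Proof.
elim: n h l => [|n IH] h l dh.
  by rewrite big_ord0; under eq_fun do rewrite big_ord0; apply: is_cderive_cst.
under eq_fun do rewrite big_ord_recl.
apply: is_cderive_eq.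
  by apply: is_cderiveM (dh _) (IH _ _ _) => i; apply: dh.
rewrite [RHS]big_ord_recl; congr (_ + _).
  rewrite big_ord_recl eqxx; congr (_ * _); apply: eq_bigr => j _.
rewrite mulr_sumr; apply: eq_bigr => i _.
rewrite [RHS]big_ord_recl /=; congr (_ * _); apply: eq_bigr => j _.
Qed.

Lemma is_cderive_conj h x l : is_cderive h x l ->
  is_cderive (fun t => (h t)^*) x l^*.
Proof.
move=> [h1 h2]; split.
  by rewrite Re_conj; under eq_fun do rewrite Re_conj.
by rewrite Im_conj; under eq_fun do rewrite Im_conj; apply: is_deriveN.
Qed.

(** The inverse is the conjugate divided by the squared modulus [g], which is real. Existence
    suffices: the derivative of a solution of a linear system is later pinned down by
    differentiating the system. *)
Lemma is_cderiveV h x l : is_cderive h x l -> h x != 0 ->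
  exists k, is_cderive (fun t => (h t)^-1) x k.
Proof.
move=> dh hx0; have [h1 h2] := dh.
pose g t := complex.Re (h t) ^+ 2 + complex.Im (h t) ^+ 2.
have gx0 : g x != 0.
  have := add_Re2_Im2 (h x); rewrite -/(g x) => gE.
  by rewrite -(inj_eq (@complexI R)) gE expf_eq0 /= normr_eq0.
have dg : is_cderive (fun t => ((g t)^-1)%:C) x (- g x ^- 2 *
   (complex.Re (h x) * complex.Re l + complex.Im (h x) * complex.Im l) *+ 2)%:C.
  split; last exact: is_derive_cst.
  have dgR : is_derive x 1 g _ :=
    is_deriveD (is_deriveM h1 h1) (is_deriveM h2 h2).
  apply: is_derive_eq (is_deriveV gx0 dgR) _.
  by rewrite /GRing.scale /=; ring.
have -> : (fun t => (h t)^-1) = fun t => (h t)^* * ((g t)^-1)%:C.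
  apply/funext => t; rewrite /g; case: (h t) => a b /=.
  rewrite /GRing.inv /GRing.mul /= !mulr0 subr0 add0r.
  by rewrite mulNr.
by eexists; apply: is_cderiveM (is_cderive_conj dh) dg.
Qed.

Definition is_mxderive m n (F : R -> 'M[R[i]]_(m, n)) x
    (F' : 'M[R[i]]_(m, n)) :=
  forall i j, is_cderive (fun t => F t i j) x (F' i j).

Lemma is_mxderive_eq m n (F : R -> 'M[R[i]]_(m, n)) x F' G' :
  is_mxderive F x F' -> F' = G' -> is_mxderive F x G'.
Proof. by move=> ? <-. Qed.

Lemma is_mxderive_cst m n (A : 'M[R[i]]_(m, n)) x :
  is_mxderive (fun _ => A) x 0.
Proof. by move=> i j; rewrite mxE; apply: is_cderive_cst. Qed.

Lemma is_mxderiveM m n p (F : R -> 'M[R[i]]_(m, n)) (G : R -> 'M_(n, p))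
    x F' G' :
  is_mxderive F x F' -> is_mxderive G x G' ->
  is_mxderive (fun t => F t *m G t) x (F' *m G x + F x *m G').
Proof.
move=> dF dG i j; rewrite !mxE -big_split; under eq_fun do rewrite mxE.
by apply: is_cderive_sum => k; apply: is_cderiveM.
Qed.

Lemma is_mxderiveMl m n p (A : 'M[R[i]]_(m, n)) (G : R -> 'M_(n, p)) x G' :
  is_mxderive G x G' -> is_mxderive (fun t => A *m G t) x (A *m G').
Proof.
move=> dG; apply: is_mxderive_eq (is_mxderiveM (is_mxderive_cst A x) dG) _.
by rewrite mul0mx add0r.
Qed.

Lemma is_mxderiveMr m n p (A : 'M[R[i]]_(n, p)) (G : R -> 'M_(m, n)) x G' :
  is_mxderive G x G' -> is_mxderive (fun t => G t *m A) x (G' *m A).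
Proof.
move=> dG; apply: is_mxderive_eq (is_mxderiveM dG (is_mxderive_cst A x)) _.
by rewrite mulmx0 addr0.
Qed.

Lemma is_mxderive_unique m n (F : R -> 'M[R[i]]_(m, n)) x F' G' :
  is_mxderive F x F' -> is_mxderive F x G' -> F' = G'.
Proof.
move=> dF dG; apply/matrixP => i j.
by rewrite -(is_cderive_cderive (dF i j)) (is_cderive_cderive (dG i j)).
Qed.

Lemma is_mxderive0_cst m n (F : R -> 'M[R[i]]_(m, n)) :
  (forall x, is_mxderive F x 0) -> forall x y, F x = F y.
Proof.
move=> dF x y; apply/matrixP => i j; apply/eqP; rewrite eq_complex; apply/andP.
split; apply/eqP.
  apply: (@is_derive_0_is_cst _ (fun t => complex.Re (F t i j))) => z.
  by have [+ _] := dF z i j; rewrite mxE.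
apply: (@is_derive_0_is_cst _ (fun t => complex.Im (F t i j))) => z.
by have [_ +] := dF z i j; rewrite mxE.
Qed.

(** Jacobi's formula, from the Leibniz expansion grouped by the row that is differentiated. *)
Lemma is_cderive_det n (F : R -> 'M[R[i]]_n) x F' : is_mxderive F x F' ->
  is_cderive (fun t => \det (F t)) x (\tr (F' *m \adj (F x))).
Proof.
move=> dF; rewrite /determinant; apply: is_cderive_eq.
  apply: is_cderive_sum => s; apply: is_cderiveZ; apply: is_cderive_prod => i.
  exact: dF.
under eq_bigr do rewrite mulr_sumr.
rewrite exchange_big; apply: eq_bigr => i _; rewrite mxE /=.
pose B := \matrix_(k, j) if k == i then F' k j else F x k j.
transitivity (\det B).
  apply: eq_bigr => s _; congr (_ * _); apply: eq_bigr => k _.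
  by rewrite mxE.
rewrite (expand_det_row _ i); apply: eq_bigr => j _.
rewrite !mxE eqxx; congr (_ * (_ * \det _)); apply/matrixP => k l.
by rewrite !mxE eq_sym (negbTE (neq_lift _ _)).
Qed.

Lemma is_mxderive_invmx n (F : R -> 'M[R[i]]_n) x F' : is_mxderive F x F' ->
  (forall t, F t \in unitmx) ->
  exists G, is_mxderive (fun t => invmx (F t)) x G.
Proof.
move=> dF Fu.
have [d dd] : exists d, is_cderive (fun t => (\det (F t))^-1) x d.
  by apply: is_cderiveV (is_cderive_det dF) _; rewrite -unitfE -unitmxE.
have dij i j : exists l, is_cderive (fun t => invmx (F t) i j) x l.
  have [dc dcE] : exists l, is_cderive (fun t => cofactor (F t) j i) x l.
    eexists; apply: is_cderiveZ.
    apply: (is_cderive_det (F' := row' j (col' i F'))) => k l.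
    by rewrite !mxE; under eq_fun do rewrite !mxE; apply: dF.
  have -> : (fun t => invmx (F t) i j) =
      fun t => (\det (F t))^-1 * cofactor (F t) j i.
    by apply/funext => t; rewrite /invmx ifT ?mxE ?mxE.
  by eexists; apply: is_cderiveM dd dcE.
exists (\matrix_(i, j) cderive (fun t => invmx (F t) i j) x) => i j.
by have [l dl] := dij i j; rewrite mxE (is_cderive_cderive dl).
Qed.

End ComplexDerivative.

(** * The matrix exponential as a power series in a real parameter *)

Section Series.
Local Open Scope classical_set_scope.
Variable R : realType.

Lemma cvg_pseries_fact (a : R^nat) (M B x : R) : 0 <= B ->
  (forall l, `|a l| <= M * (B ^+ l / l`!%:R)) -> cvgn (pseries a x).
Proof.
move=> B0 ale; apply: normed_cvg.
have v0 l : 0 <= M * exp_coeff (B * `|x|) l.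
  rewrite /exp_coeff /= exprMn mulrAC mulrA mulr_ge0 ?exprn_ge0 //.
  exact: le_trans (ale l).
apply: (series_le_cvg _ v0) => [l|l|] //=.
  rewrite normrM normrX /exp_coeff /= exprMn mulrAC mulrA.
  by rewrite ler_wpM2r ?exprn_ge0.
apply: (@is_cvg_seriesZ _ _ M); exact: is_cvg_series_exp_coeff.
Qed.

(** Bounds of exponential type survive termwise differentiation at the cost of a factor [B], so a
    single bound controls the series and the two derived series that termwise differentiation
    requires. *)
Lemma pseries_diffs_fact (a : R^nat) (M B : R) :
  (forall l, `|a l| <= M * (B ^+ l / l`!%:R)) ->
  forall l, `|pseries_diffs a l| <= M * B * (B ^+ l / l`!%:R).
Proof.
move=> ale l; rewrite /pseries_diffs normrM ger0_norm // mulrC.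
rewrite -ler_pdivlMr ?ltr0n // (le_trans (ale _)) // exprS factS natrM invfM.
by rewrite le_eqVlt; apply/orP; left; apply/eqP; ring.
Qed.

Lemma is_derive_pseries_fact (a : R^nat) (M B x : R) : 0 <= B ->
  (forall l, `|a l| <= M * (B ^+ l / l`!%:R)) ->
  is_derive x (1 : R) (fun t => limn (pseries a t))
    (limn (pseries (pseries_diffs a) x)).
Proof.
move=> B0 ale; have ale1 := pseries_diffs_fact ale.
apply: (@pseries_snd_diffs _ _ (`|x| + 1)).
- exact: cvg_pseries_fact ale.
- exact: cvg_pseries_fact ale1.
- exact: cvg_pseries_fact (pseries_diffs_fact ale1).
- by rewrite [ltRHS]ger0_norm ?addr_ge0 // ltrDl.
Qed.

Definition cvgc (u : nat -> R[i]) (l : R[i]) :=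
  (fun k => complex.Re (u k)) @ \oo --> complex.Re l /\
  (fun k => complex.Im (u k)) @ \oo --> complex.Im l.

Lemma cvgc_lim u l : cvgc u l -> climn u = l.
Proof.
by case: l => a b [/= ua ub]; congr (_ +i* _); apply: cvg_lim.
Qed.

Lemma cvgc_unique u l k : cvgc u l -> cvgc u k -> l = k.
Proof. by move=> /cvgc_lim <- /cvgc_lim. Qed.

Lemma cvgc_cst l : cvgc (fun _ => l) l.
Proof. by split; apply: cvg_cst. Qed.

Lemma cvgcD u v l k : cvgc u l -> cvgc v k -> cvgc (fun n => u n + v n) (l + k).
Proof.
move=> [u1 u2] [v1 v2]; split.
  by rewrite Re_add; under eq_fun do rewrite Re_add; apply: cvgD.
by rewrite Im_add; under eq_fun do rewrite Im_add; apply: cvgD.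
Qed.

Lemma cvgcZ c u l : cvgc u l -> cvgc (fun n => c * u n) (c * l).
Proof.
move=> [u1 u2]; split.
  rewrite Re_mul; under eq_fun do rewrite Re_mul.
  by apply: cvgB; apply: cvgM => //; apply: cvg_cst.
rewrite Im_mul; under eq_fun do rewrite Im_mul.
by apply: cvgD; apply: cvgM => //; apply: cvg_cst.
Qed.

Lemma cvgc_sum (I : Type) (r : seq I) (u : I -> nat -> R[i]) l :
  (forall i, cvgc (u i) (l i)) ->
  cvgc (fun n => \sum_(i <- r) u i n) (\sum_(i <- r) l i).
Proof.
move=> ul; elim: r => [|i r IH].
  by rewrite big_nil; under eq_fun do rewrite big_nil; apply: cvgc_cst.
by rewrite big_cons; under eq_fun do rewrite big_cons; apply: cvgcD.
Qed.

Lemma cvgc_conj u l : cvgc u l -> cvgc (fun n => (u n)^*) l^*.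
Proof.
move=> [h1 h2]; split.
  by rewrite Re_conj; under eq_fun do rewrite Re_conj.
by rewrite Im_conj; under eq_fun do rewrite Im_conj; apply: cvgN.
Qed.

Lemma normr_Re_le (z : R[i]) : `|complex.Re z| <= normc z.
Proof.
by case: z => a b; rewrite /= -sqrtr_sqr ler_wsqrtr // lerDl sqr_ge0.
Qed.

Lemma normr_Im_le (z : R[i]) : `|complex.Im z| <= normc z.
Proof.
by case: z => a b; rewrite /= -sqrtr_sqr ler_wsqrtr // lerDr sqr_ge0.
Qed.

Lemma normc_sum_le (I : Type) (r : seq I) (F : I -> R[i]) :
  normc (\sum_(i <- r) F i) <= \sum_(i <- r) normc (F i).
Proof.
elim: r => [|i r IH]; first by rewrite !big_nil normc0.
by rewrite !big_cons (le_trans (le_normcD _ _)) // lerD2l.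
Qed.

Lemma normc_ge0 (z : R[i]) : 0 <= normc z.
Proof. by case: z => a b; apply: sqrtr_ge0. Qed.

Section Exponential.
Variable n : nat.
Implicit Types (A B : 'M[R[i]]_n).

Definition expmx_series A k : 'M[R[i]]_n := \sum_(l < k) (l`!%:R)^-1 *: A ^+ l.

Lemma normc_exp_entry A : exists2 B : R, 0 <= B &
  forall l i j, normc ((A ^+ l) i j) <= B ^+ l.
Proof.
exists (\sum_i \sum_k normc (A i k)).
  by apply: sumr_ge0 => i _; apply: sumr_ge0 => k _; apply: normc_ge0.
elim=> [|l IH] i j.
  rewrite expr0 mxE; case: eqP => _; first by rewrite mulr1n normc1.
  by rewrite mulr0n normc0.
rewrite exprS mxE (le_trans (normc_sum_le _ _)) //.
apply: le_trans
  (_ : \sum_k normc (A i k) * (\sum_i \sum_k normc (A i k)) ^+ l <= _).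
  by apply: ler_sum => k _; rewrite normcM ler_wpM2l ?normc_ge0.
rewrite -mulr_suml exprS ler_wpM2r //.
  apply: exprn_ge0.
  by apply: sumr_ge0 => {}i _; apply: sumr_ge0 => k _; apply: normc_ge0.
rewrite [leRHS](bigD1 i) //= lerDl.
by apply: sumr_ge0 => {}k _; apply: sumr_ge0 => {}j _; apply: normc_ge0.
Qed.

Lemma series_entry A i j k :
  (expmx_series A k) i j = \sum_(l < k) (l`!%:R)^-1 * (A ^+ l) i j.
Proof. by rewrite summxE; apply: eq_bigr => l _; rewrite mxE. Qed.

(** With [f] the real or imaginary part, these are the coefficients of a real power series in [t]
    for one entry of [expmx (t%:C *: A)]. *)
Definition taylor_coef (f : R[i] -> R) A i j l : R := f ((A ^+ l) i j) / l`!%:R.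

Lemma real_invfact l : (l`!%:R)^-1 = ((l`!%:R)^-1 : R)%:C.
Proof. by rewrite fmorphV rmorph_nat. Qed.

Lemma exp_realZ A (t : R) l : (t%:C *: A) ^+ l = (t ^+ l)%:C *: A ^+ l.
Proof.
elim: l => [|l IH]; first by rewrite !expr0 scale1r.
by rewrite !exprS IH -!mulmxE -scalemxAl -scalemxAr scalerA -rmorphM.
Qed.

Lemma ReZ (t : R) (z : R[i]) : complex.Re (t%:C * z) = t * complex.Re z.
Proof. by rewrite Re_mul /= mul0r subr0. Qed.

Lemma ImZ (t : R) (z : R[i]) : complex.Im (t%:C * z) = t * complex.Im z.
Proof. by rewrite Im_mul /= mul0r addr0. Qed.

Lemma Re_sum (I : Type) (r : seq I) (F : I -> R[i]) :
  complex.Re (\sum_(i <- r) F i) = \sum_(i <- r) complex.Re (F i).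
Proof. by elim: r => [|i r IH]; rewrite ?big_nil // !big_cons Re_add IH. Qed.

Lemma Im_sum (I : Type) (r : seq I) (F : I -> R[i]) :
  complex.Im (\sum_(i <- r) F i) = \sum_(i <- r) complex.Im (F i).
Proof. by elim: r => [|i r IH]; rewrite ?big_nil // !big_cons Im_add IH. Qed.

Lemma Re_expmx_series A t i j :
  (fun k => complex.Re (expmx_series (t%:C *: A) k i j)) =
  pseries (taylor_coef (@complex.Re R) A i j) t.
Proof.
apply/funext => k; rewrite series_entry Re_sum /pseries /series /= big_mkord.
apply: eq_bigr => l _; rewrite real_invfact exp_realZ mxE !ReZ /taylor_coef.
by ring.
Qed.

Lemma Im_expmx_series A t i j :
  (fun k => complex.Im (expmx_series (t%:C *: A) k i j)) =
  pseries (taylor_coef (@complex.Im R) A i j) t.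
Proof.
apply/funext => k; rewrite series_entry Im_sum /pseries /series /= big_mkord.
apply: eq_bigr => l _; rewrite real_invfact exp_realZ mxE !ImZ /taylor_coef.
by ring.
Qed.

Lemma taylor_coef_le A : exists2 B : R, 0 <= B & forall i j l,
  `|taylor_coef (@complex.Re R) A i j l| <= 1 * (B ^+ l / l`!%:R) /\
  `|taylor_coef (@complex.Im R) A i j l| <= 1 * (B ^+ l / l`!%:R).
Proof.
have [B B0 leB] := normc_exp_entry A; exists B => // i j l.
rewrite mul1r !normrM [`|_^-1|]ger0_norm ?invr_ge0 //.
rewrite !ler_wpM2r ?invr_ge0 // (le_trans _ (leB l i j)) ?normr_Re_le //.
exact: normr_Im_le.
Qed.

Lemma cvgc_expmx A i j : cvgc (fun k => expmx_series A k i j) (expmx A i j).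
Proof.
have [B B0 leB] := taylor_coef_le A.
(* The partial sums for [A] are those of the real power series evaluated at [t = 1]. *)
have eA : A = (1 : R)%:C *: A by rewrite scale1r.
have cR : cvgn (fun k => complex.Re (expmx_series A k i j)).
  rewrite eA Re_expmx_series.
  apply: cvg_pseries_fact B0 _ => l; exact: (leB i j l).1.
have cI : cvgn (fun k => complex.Im (expmx_series A k i j)).
  rewrite eA Im_expmx_series.
  apply: cvg_pseries_fact B0 _ => l; exact: (leB i j l).2.
by rewrite mxE; split.
Qed.

Lemma cvgc_mul_expmx m p (X : 'M_(m, n)) (Y : 'M_(n, p)) A i j :
  cvgc (fun k => (X *m expmx_series A k *m Y) i j) ((X *m expmx A *m Y) i j).
Proof.
rewrite mxE; under eq_fun do rewrite mxE.
apply: cvgc_sum => k; rewrite mulrC; under eq_fun do rewrite mulrC.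
apply: cvgcZ; rewrite mxE; under eq_fun do rewrite mxE.
by apply: cvgc_sum => l; apply: cvgcZ; apply: cvgc_expmx.
Qed.

Lemma exp_intertwine A B X l : A *m X = X *m B -> A ^+ l *m X = X *m B ^+ l.
Proof.
move=> AX; elim: l => [|l IH]; first by rewrite !expr0 mulmx1 mul1mx.
by rewrite !exprS -!mulmxE -mulmxA IH !mulmxA AX.
Qed.

(** The identity holds for every partial sum and passes to the limit. It serves both for
    commutation, with [A = B], and for transport through [T]. *)
Lemma expmx_intertwine A B X : A *m X = X *m B -> expmx A *m X = X *m expmx B.
Proof.
move=> AX.
apply/matrixP => i j; rewrite -[expmx A]mul1mx -[X in RHS]mulmx1.
apply: cvgc_unique (cvgc_mul_expmx _ _ _ _ _) _.
rewrite mulmx1 -[X *m expmx B]mulmx1.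
have -> : (fun k => (1%:M *m expmx_series A k *m X) i j) =
   (fun k => (X *m expmx_series B k *m 1%:M) i j).
  apply/funext => k; rewrite mul1mx mulmx1 mulmx_suml mulmx_sumr !summxE.
  by apply: eq_bigr => l _; rewrite -scalemxAl (exp_intertwine _ AX) scalemxAr.
exact: cvgc_mul_expmx.
Qed.

Lemma conjc_mxX A l : conjc_mx (A ^+ l) = conjc_mx A ^+ l.
Proof.
elim: l => [|l IH]; first by rewrite /conjc_mx !expr0 map_mx1.
by rewrite !exprS -!mulmxE -IH /conjc_mx map_mxM.
Qed.

Lemma conj_expmx A : conjc_mx (expmx A) = expmx (conjc_mx A).
Proof.
apply/matrixP => i j; rewrite mxE.
apply: cvgc_unique (cvgc_conj (cvgc_expmx _ _ _)) _.
have -> : (fun k => (expmx_series A k i j)^*) =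
   (fun k => expmx_series (conjc_mx A) k i j).
  apply/funext => k; rewrite !series_entry rmorph_sum; apply: eq_bigr => l _.
  rewrite rmorphM /= fmorphV rmorph_nat; congr (_ * _).
  by rewrite -conjc_mxX mxE.
exact: cvgc_expmx.
Qed.

Lemma expmx0 : expmx (0 : 'M[R[i]]_n) = 1%:M.
Proof.
apply/matrixP => i j; apply: cvgc_unique (cvgc_expmx _ _ _) _.
have series0 k : expmx_series 0 k.+1 i j = (1%:M : 'M[R[i]]_n) i j.
  rewrite /expmx_series big_ord_recl expr0 fact0 invr1 scale1r big1 ?addr0 //.
  by move=> l _; rewrite /= exprS mul0r scaler0.
(* The partial sum of index 0 is empty, so the sequence is constant only from index 1 on. *)
split; rewrite -cvg_shiftS /=; under eq_fun do rewrite series0; exact: cvg_cst.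
Qed.

Lemma is_mxderive_expmx A (t : R) :
  is_mxderive (fun t => expmx (t%:C *: A)) t (A *m expmx (t%:C *: A)).
Proof.
move=> i j; have [B B0 leB] := taylor_coef_le A.
have cv : cvgc (fun k => (A *m expmx_series (t%:C *: A) k) i j)
               ((A *m expmx (t%:C *: A)) i j).
  rewrite -[A *m expmx _]mulmx1; under eq_fun do rewrite -[A *m _]mulmx1.
  exact: cvgc_mul_expmx.
have partial k : (A *m expmx_series (t%:C *: A) k) i j =
    \sum_(l < k) (t ^+ l / l`!%:R)%:C * (A ^+ l.+1) i j.
  rewrite mulmx_sumr summxE; apply: eq_bigr => l _.
  rewrite -scalemxAr exp_realZ -scalemxAr scalerA [LHS]mxE exprS.
  by rewrite real_invfact -rmorphM /= [X in X%:C]mulrC.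
case: cv => cv1 cv2; split.
- have -> : complex.Re ((A *m expmx (t%:C *: A)) i j) =
      limn (pseries (pseries_diffs (taylor_coef (@complex.Re R) A i j)) t).
    rewrite (_ : pseries _ t = fun k =>
      complex.Re ((A *m expmx_series (t%:C *: A) k) i j)).
      by apply/esym/cvg_lim.
    apply/funext => k; rewrite partial Re_sum /pseries /series /= big_mkord.
    apply: eq_bigr => l _; rewrite ReZ /pseries_diffs /taylor_coef factS natrM.
    rewrite invfM [X in _ * X * _]mulrC !mulrA mulfV ?pnatr_eq0 // mul1r.
    by ring.
  have -> : (fun t => complex.Re (expmx (t%:C *: A) i j)) =
      fun t => limn (pseries (taylor_coef (@complex.Re R) A i j) t).
    by apply/funext => s; rewrite mxE /= -Re_expmx_series.
  apply: is_derive_pseries_fact B0 _ => l; exact: (leB i j l).1.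
- have -> : complex.Im ((A *m expmx (t%:C *: A)) i j) =
      limn (pseries (pseries_diffs (taylor_coef (@complex.Im R) A i j)) t).
    rewrite (_ : pseries _ t = fun k =>
      complex.Im ((A *m expmx_series (t%:C *: A) k) i j)).
      by apply/esym/cvg_lim.
    apply/funext => k; rewrite partial Im_sum /pseries /series /= big_mkord.
    apply: eq_bigr => l _; rewrite ImZ /pseries_diffs /taylor_coef factS natrM.
    rewrite invfM [X in _ * X * _]mulrC !mulrA mulfV ?pnatr_eq0 // mul1r.
    by ring.
  have -> : (fun t => complex.Im (expmx (t%:C *: A) i j)) =
      fun t => limn (pseries (taylor_coef (@complex.Im R) A i j) t).
    by apply/funext => s; rewrite mxE /= -Im_expmx_series.
  apply: is_derive_pseries_fact B0 _ => l; exact: (leB i j l).2.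
Qed.

End Exponential.
End Series.

(** * The addition law for commuting matrices *)

Section ExponentialLaw.
Variables (R : realType) (n : nat).
Implicit Types A B : 'M[R[i]]_n.

Lemma expmxZ_comm A B (t : R) : A *m B = B *m A ->
  expmx (t%:C *: A) *m B = B *m expmx (t%:C *: A).
Proof.
by move=> AB; apply: expmx_intertwine; rewrite -scalemxAl AB -scalemxAr.
Qed.

Lemma expmx_mulN A : expmx A *m expmx (- A) = 1%:M.
Proof.
pose Y (t : R) := expmx (t%:C *: A) *m expmx (t%:C *: - A).
suff YE : forall t, is_mxderive Y t 0.
  have := is_mxderive0_cst YE 1 0.
  by rewrite /Y !scale1r !scale0r expmx0 mulmx1.
move=> t; have dA := is_mxderive_expmx A t.
have dN := is_mxderive_expmx (- A) t.
apply: is_mxderive_eq (is_mxderiveM dA dN) _.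
by rewrite mulmxA mulmxN expmxZ_comm // mulNmx subrr.
Qed.

Lemma expmxD_derive0 A B (a b c : 'M[R[i]]_n) : A *m B = B *m A ->
  a *m A = A *m a -> a *m B = B *m a -> b *m A = A *m b -> b *m B = B *m b ->
  (- B *m b *m a + b *m (- A *m a)) *m c + b *m a *m ((A + B) *m c) = 0.
Proof.
move=> AB aA aB bA bB; rewrite [X in _ + X]mulmxA -mulmxDl.
rewrite -(mulmxA b) mulmxDr aA aB -mulmxDl (mulmxA b (A + B)) mulmxDr bA bB.
rewrite !mulNmx mulmxN mulmxA bA -opprD.
by rewrite [A *m b + _]addrC -[in X in - X]mulmxDl addNr mul0mx.
Qed.

(** No product of series is formed: [Z] has derivative zero, hence keeps its value at [t = 0], the
    identity, and the inverses are then moved across. *)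
Lemma expmxD A B : A *m B = B *m A -> expmx (A + B) = expmx A *m expmx B.
Proof.
move=> AB; pose b (t : R) := expmx (t%:C *: - B).
pose a (t : R) := expmx (t%:C *: - A).
pose Z (t : R) := b t *m a t *m expmx (t%:C *: (A + B)).
suff ZE : forall t, is_mxderive Z t 0.
  have := is_mxderive0_cst ZE 1 0.
  rewrite /Z /a /b !scale1r !scale0r expmx0 !mulmx1 => Z1.
  move: (expmx_mulN A) (expmx_mulN B) Z1.
  move: (expmx A) (expmx (- A)) (expmx B) (expmx (- B)) (expmx (A + B)).
  move=> eA eNA eB eNB eD AK BK Z1; rewrite -[LHS]mul1mx -AK.
  by rewrite -[eA in LHS]mulmx1 -BK -!mulmxA (mulmxA eNB) Z1 mulmx1.
move=> t; have dB : is_mxderive b t (- B *m b t) := is_mxderive_expmx (- B) t.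
have dA : is_mxderive a t (- A *m a t) := is_mxderive_expmx (- A) t.
have dAB := is_mxderive_expmx (A + B) t.
apply: is_mxderive_eq (is_mxderiveM (is_mxderiveM dB dA) dAB) _.
have NAB (X Y : 'M[R[i]]_n) : X *m Y = Y *m X -> - X *m Y = Y *m - X.
  by move=> XY; rewrite mulNmx mulmxN XY.
by apply: expmxD_derive0; rewrite // expmxZ_comm // NAB.
Qed.

End ExponentialLaw.

(** Indices 1 and 0 refer to [m + 1] and [m]; [a] is the coefficient of degree [N] of ['X * Q], [t]
    is the trace of [K], and [4 k] is [delta]. *)
Lemma sine_gordon_field (F : fieldType) (a1 a0 s1 s0 p1 p0 q1 q0 k t : F) :
  a1 - k * q1 = a0 + (p1 - p0 + k) * q0 + (q1 - q0) * s0 ->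
  s0 = - t - p0 -> s1 = - t - p1 ->
  2 * (- 2 * (a1 *+ 2 - 2 * q1 * s1) - - 2 * (a0 *+ 2 - 2 * q0 * s0)) +
  (- 2 * q1 + - 2 * q0) * (2 * ((- t - 2 * p1) - (- t - 2 * p0)) - 4 * k) = 0.
Proof. by move=> /eqP; rewrite subr_eq => /eqP -> -> ->; ring. Qed.

(** * Conjugation of polynomial relations *)

Section PolynomialScaling.
Variables (F : fieldType) (n : nat).

Lemma horner_mx_intertwine (A B T : 'M[F]_n.+1) c (P : {poly F}) :
  T *m B = c *: A *m T ->
  T *m horner_mx B P = horner_mx A (P \Po (c *: 'X)) *m T.
Proof.
move=> TB; elim/poly_ind: P => [|P d IH].
  by rewrite comp_poly0 !rmorph0 mulmx0 mul0mx.
rewrite comp_poly_MXaddC !rmorphD !rmorphM /= !horner_mx_C !linearZ /=.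
rewrite !horner_mx_X.
rewrite mulmxDr mulmxDl scalar_mxC -!mulmxE mulmxA IH -!mulmxA TB.
by rewrite mulmxA.
Qed.

Lemma coef_comp_polyZX c (P : {poly F}) i :
  (P \Po (c *: 'X))`_i = c ^+ i * P`_i.
Proof.
rewrite comp_polyE (_ : \sum_(_ < _) _ = \poly_(j < size P) (c ^+ j * P`_j)).
  rewrite coef_poly; case: ltnP => // sP.
  by rewrite [P`__]nth_default // mulr0.
rewrite poly_def; apply: eq_bigr => j _.
by rewrite exprZn scalerA mulrC.
Qed.

End PolynomialScaling.

Lemma conjc_mxK (R : realType) p q (A : 'M[R[i]]_(p, q)) :
  conjc_mx (conjc_mx A) = A.
Proof. by apply/matrixP => i j; rewrite !mxE conjcK. Qed.

(** Conjugate the relation and apply [T]: [phi1] becomes [psi] and [psi1] becomes [a] times [phi],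
    so the two polynomials change places and ['X] is rescaled by [c]. *)
Lemma polyrel_conj (R : realType) n (K T : 'M[R[i]]_n.+1) phi psi phi1 psi1
    (a c : R[i]) (P Q : {poly R[i]}) :
  T *m conjc_mx K = c *: K *m T -> T *m conjc_mx T = a%:M ->
  psi = T *m conjc_mx phi1 -> psi1 = T *m conjc_mx phi ->
  polyrel K phi1 psi1 P Q = 0 ->
  polyrel K phi psi (a *: (map_poly conjc Q \Po (c *: 'X)))
                    (map_poly conjc P \Po (c *: 'X)) = 0.
Proof.
move=> TK TT -> -> rel.
have hT A : T *m conjc_mx (horner_mx K A) =
    horner_mx K (map_poly conjc A \Po (c *: 'X)) *m T.
  by rewrite /conjc_mx map_horner_mx; apply: horner_mx_intertwine.
have hM p q r (A : 'M[R[i]]_(p, q)) (B : 'M_(q, r)) :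
    conjc_mx (A *m B) = conjc_mx A *m conjc_mx B by apply: map_mxM.
have hTM A (u : 'cV_n.+1) : T *m conjc_mx (horner_mx K A *m u) =
    horner_mx K (map_poly conjc A \Po (c *: 'X)) *m (T *m conjc_mx u).
  by rewrite hM mulmxA hT mulmxA.
have hTT (u : 'cV_n.+1) : T *m conjc_mx (T *m conjc_mx u) = a *: u.
  by rewrite hM conjc_mxK mulmxA TT mul_scalar_mx.
have conjD (u1 u2 : 'cV[R[i]]_n.+1) :
  conjc_mx (u1 + u2) = conjc_mx u1 + conjc_mx u2 by apply: map_mxD.
have conj0 : conjc_mx 0 = 0 :> 'cV[R[i]]_n.+1 by apply: map_mx0.
have := congr1 (fun z => T *m conjc_mx z) rel.
rewrite /polyrel /= conjD mulmxDr (hTM P) (hTM Q) hTT conj0 mulmx0 => <-.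
rewrite addrC; congr (_ + _).
have -> A : horner_mx K (a *: A) = a *: horner_mx K A by exact: linearZ.
by rewrite -scalemxAl scalemxAr.
Qed.

(** * The equations for [chi] and [varpi], from abstract properties of [phi] and [psi] *)

Section Solution.
Variables (R : realType) (eta sigma : int) (n N : nat).
Hypothesis n_def : n.+1 = (2 * N.+1)%N.
Variables (kappa : R) (K U T : 'M[R[i]]_n.+1).
Variables (phi psi : R -> int -> 'cV[R[i]]_n.+1).
Hypothesis sigma_sign : sigma = 1 \/ sigma = -1.
Hypothesis phi_dx : forall x m, is_mxderive (phi ^~ m) x (K *m phi x m).
Hypothesis psi_dx : forall x m, is_mxderive (psi ^~ m) x (- K *m psi x m).
Hypothesis phi_shift : forall x m, phi x (m + 1) = U *m phi x m.
Hypothesis psi_shift : forall x m, U *m psi x (m + 1) = psi x m.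
Hypothesis UK : U *m K = K *m U.
Hypothesis KU : (K - kappa%:C%:M) *m (U *m U) = K + kappa%:C%:M.
Hypothesis TK : T *m conjc_mx K = (- sigma%:~R) *: K *m T.
Hypothesis psiE : forall x m,
  psi x m = T *m conjc_mx (phi (sigma%:~R * x) (sigma * m)).
Hypothesis T_conj : T *m conjc_mx T = (- (sigma * eta)%:~R)%:M.
Hypothesis W_unit : forall x m, wronskmx N K (phi x m) (psi x m) \in unitmx.

Let W x m := wronskmx N K (phi x m) (psi x m).
Let v x m := invmx (W x m) *m (K ^+ N.+1 *m phi x m).
Let w x m := invmx (W x m) *m ((- K) ^+ N.+1 *m psi x m).
Let P x m : {poly R[i]} := 'X^(N.+1) - lowpoly N (v x m).
Let Q x m : {poly R[i]} := - highpoly N (v x m).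
Let Rp x m : {poly R[i]} := ((-1) ^+ N)%:P * lowpoly N (w x m).
Let S x m : {poly R[i]} := 'X^(N.+1) + ((-1) ^+ N)%:P * highpoly N (w x m).
Let p x m : R[i] := (P x m)`_N.
Let q x m : R[i] := (Q x m)`_N.

Let n_half : n = (N + N.+1)%N.
Proof. by apply: succn_inj; rewrite n_def mul2n -addnn addSn. Qed.

Let rel_PQ x m : polyrel K (phi x m) (psi x m) (P x m) (Q x m) = 0.
Proof. by apply: polyrel_low => //; rewrite /v mulKVmx. Qed.

Let rel_RS x m : polyrel K (phi x m) (psi x m) (Rp x m) (S x m) = 0.
Proof. by apply: polyrel_high => //; rewrite /w mulKVmx. Qed.

Let size_P x m : (size (P x m - 'X^(N.+1))%R <= N.+1)%N.
Proof. by rewrite /P addrC addKr size_polyN size_lowpoly. Qed.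

Let size_Q x m : (size (Q x m) <= N.+1)%N.
Proof. by rewrite /Q size_polyN size_highpoly. Qed.

Let size_R x m : (size (Rp x m) <= N.+1)%N.
Proof. by rewrite /Rp mul_polyC size_polyZ_le // size_lowpoly. Qed.

Let size_S x m : (size (S x m - 'X^(N.+1))%R <= N.+1)%N.
Proof. by rewrite /S addrC addKr mul_polyC size_polyZ_le // size_highpoly. Qed.

Let ind x m : relindep N K (phi x m) (psi x m).
Proof. exact: wronskmx_relindep. Qed.

Let inord_max : inord (N.+1 + N) = ord_max :> 'I_n.+1.
Proof. by apply: val_inj; rewrite /= inordK n_half addnC. Qed.

Let pE x m : p x m = - v x m (inord N) 0.
Proof. by rewrite /p /P coefB coefXn coef_poly ltnSn ltn_eqF // sub0r. Qed.

Let qE x m : q x m = - (-1) ^+ N * v x m ord_max 0.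
Proof. by rewrite /q /Q coefN coef_poly ltnSn inord_max mulNr. Qed.

Let sE x m : (S x m)`_N = w x m ord_max 0.
Proof.
rewrite /S coefD coefXn coefCM coef_poly ltnSn ltn_eqF // add0r inord_max mulrA.
by rewrite -exprMn mulrN1 opprK expr1n mul1r.
Qed.

Let trK x m : \tr K = - p x m - (S x m)`_N.
Proof. by rewrite pE sE opprK (wronskmx_tr n_def (W_unit x m)). Qed.

Let det_W_neq0 x m : \det (W x m) != 0.
Proof. by rewrite -unitfE -unitmxE W_unit. Qed.

Let adjE x m : \adj (W x m) = \det (W x m) *: invmx (W x m).
Proof. by rewrite /invmx W_unit scalerA mulfV ?scale1r. Qed.

Let chiE x m : 2 * block_det N.+2 (fun j => K ^+ j *m phi x m)
   (fun j => (- K) ^+ j *m psi x m) / \det (W x m) = - 2 * q x m.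
Proof.
have leN : (N.+1 <= n)%N by rewrite n_half leq_addl.
have -> : block_det N.+2 (fun j => K ^+ j *m phi x m)
    (fun j => (- K) ^+ j *m psi x m) =
    (-1) ^+ (N.+1 + n) *
      (\adj (W x m) *m (K ^+ N.+1 *m phi x m)) ord_max 0.
  exact: (det_blockmxS (fun j => K ^+ j *m phi x m)
    (fun j => (- K) ^+ j *m psi x m) leN).
rewrite adjE -scalemxAl mxE -/(v x m) qE.
(* Here [n = 2 N + 1], so the exponent is [N] plus twice [N + 1]. *)
have -> : (-1) ^+ (N.+1 + n) = (-1) ^+ N :> R[i].
  by rewrite n_half addnCA exprD addnn -muln2 exprM sqrr_sign mulr1.
field; exact: det_W_neq0.
Qed.

Let W_dx x m : is_mxderive (W ^~ m) x
  (wronskmx N K (K *m phi x m) (- K *m psi x m)).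
Proof.
move=> i j; rewrite mxE; under eq_fun do rewrite mxE.
by case: ifP => _; apply: is_mxderiveMl.
Qed.

(** Jacobi's formula gives [s - p]; the trace identity removes [s], so that the derivative of
    [varpi] needs only that of [p]. *)
Let varpiE x m : dx (fun y k => block_det N.+1 (fun j => K ^+ j *m phi y k)
    (fun j => (- K) ^+ j *m psi y k)) x m / \det (W x m) =
  - \tr K - 2 * p x m.
Proof.
rewrite /dx (is_cderive_cderive (is_cderive_det (W_dx x m))) adjE -scalemxAr.
rewrite mxtraceZ mxtrace_mulC mulrC mulKf // wronskmx_tr_dx //.
by rewrite (trK x m) pE sE; ring.
Qed.

(** Differentiability comes from the inverse matrix; the equation for [v'] comes from
    differentiating [W v = K ^+ N.+1 phi] in two ways. *)
Let v_dx x m : exists v', is_mxderive (v ^~ m) x v' /\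
  wronskmx N K (K *m phi x m) (- K *m psi x m) *m v x m + W x m *m v' =
  K ^+ N.+1 *m (K *m phi x m).
Proof.
have [G dG] := is_mxderive_invmx (W_dx x m) (fun t => W_unit t m).
have dv := is_mxderiveM dG (is_mxderiveMl (K ^+ N.+1) (phi_dx x m)).
eexists; split; first exact: dv.
apply: (is_mxderive_unique (is_mxderiveM (W_dx x m) dv)).
rewrite (_ : (fun t => _) = fun t => K ^+ N.+1 *m phi t m).
  exact: is_mxderiveMl.
by apply/funext => t; rewrite /v mulKVmx //; apply: W_unit.
Qed.

Let pq_dx x m : is_cderive (p ^~ m) x (- 2 * q x m * (Rp x m)`_N) /\
  is_cderive (q ^~ m) x (('X * Q x m)`_N *+ 2 - 2 * q x m * (S x m)`_N).
Proof.
have [v' [dv eq_v]] := v_dx x m.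
have [] := @relindep_x _ n N K (phi x m) (psi x m) (P x m) (Q x m)
  (Rp x m) (S x m) (- lowpoly N v') (- highpoly N v') (@ind x m) _ _
  (size_Q x m) (size_R x m) (size_S x m) (rel_RS x m) _ (rel_PQ x m).
- by rewrite size_polyN size_lowpoly.
- by rewrite size_polyN size_highpoly.
- rewrite polyrelN -wronskmx_mul //.
  have <- : - (W x m *m v') + (K ^+ N.+1 *m (K *m phi x m) -
     wronskmx N K (K *m phi x m) (- K *m psi x m) *m v x m) = 0.
    by rewrite -eq_v [X in _ + (X - _)]addrC addrK addNr.
  by rewrite polyrel_mulX -wronskmx_mul.
rewrite -/(q x m) => <- <-; rewrite !coefN !coef_poly ltnSn inord_max; split.
  by under eq_fun do rewrite pE; apply: is_cderiveN.
by under eq_fun do rewrite qE mulNr; apply: is_cderiveN; apply: is_cderiveZ.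
Qed.

Let shift_rel x m :
  ('X * Q x (m + 1))`_N - kappa%:C * q x (m + 1) =
  ('X * Q x m)`_N + (p x (m + 1) - p x m + kappa%:C) * q x m +
  (q x (m + 1) - q x m) * (S x m)`_N.
Proof.
apply: (relindep_shift (P := P x m) (R := Rp x m) (@ind x m)) => //.
exact: polyrel_shift UK KU (phi_shift x m) (psi_shift x m) (rel_PQ x (m + 1)).
Qed.

Let sigma_sq : sigma * sigma = 1.
Proof. by case: sigma_sign => ->. Qed.

Let sigmaK (y : R) : sigma%:~R * (sigma%:~R * y) = y.
Proof. by rewrite mulrA -intrM sigma_sq mul1r. Qed.

Let conj_rel x m :
  (Rp x m)`_N = eta%:~R * (q (sigma%:~R * x) (sigma * m))^*.
Proof.
set y := _ * x; set k := _ * m; pose c : R[i] := - sigma%:~R.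
have cc : c * c = 1 by rewrite mulrNN -intrM sigma_sq.
pose Pc := map_poly conjc (P y k) \Po (c *: 'X).
pose Qc := map_poly conjc (Q y k) \Po (c *: 'X).
have rel : polyrel K (phi x m) (psi x m) (- (sigma * eta)%:~R *: Qc) Pc = 0.
  apply: (polyrel_conj TK T_conj (psiE x m) _ (rel_PQ y k)).
  by rewrite psiE sigmaK mulrA sigma_sq mul1r.
have coefPc i : Pc`_i = c ^+ i * ((P y k)`_i)^*.
  by rewrite coef_comp_polyZX coef_map.
have coefQc i : Qc`_i = c ^+ i * ((Q y k)`_i)^*.
  by rewrite coef_comp_polyZX coef_map.
have [P_N1 sP] := subXn_size (size_P y k).
have sPc : (size Pc <= N.+2)%N.
  apply/leq_sizeP => j Nj.
  by rewrite coefPc nth_default ?(leq_trans sP) // rmorph0 mulr0.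
have sQc : (size Qc <= N.+1)%N.
  apply/leq_sizeP => j Nj.
  by rewrite coefQc nth_default ?(leq_trans (size_Q y k)) // rmorph0 mulr0.
(* The conjugated polynomial [Pc] has leading coefficient [c ^+ N.+1]; as [c * c = 1], multiplying
   by the same power makes it monic, and uniqueness applies. *)
have RE : Rp x m = (c ^+ N.+1)%:P * (- (sigma * eta)%:~R *: Qc).
  refine (relindep_uniq (@ind x m) (size_R x m) (size_S x m) _ _ (rel_RS x m)
    (_ : polyrel _ _ _ _ ((c ^+ N.+1)%:P * Pc) = 0)).
  - by rewrite mul_polyC; do 2!apply: size_polyZ_le.
  - rewrite mul_polyC; apply: size_coef_le.
      by apply: size_polyB_le; [apply: size_polyZ_le | rewrite size_polyXn].
    rewrite coefB coefZ coefPc coefXn eqxx P_N1 rmorph1 mulr1 -exprMn cc.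
    by rewrite expr1n subrr.
  - by rewrite polyrelM rel mulmx0.
rewrite RE.
rewrite coefCM coefZ coefQc -/(q y k) exprS intrM.
transitivity (c * (- sigma%:~R) * eta%:~R * (c * c) ^+ N * (q y k)^*).
  by rewrite exprMn; ring.
by rewrite -/c cc expr1n mul1r mulr1.
Qed.

Theorem wronskian_solution : semidiscrete_sine_gordon eta sigma (4 * kappa)
  (fun x m => 2 * block_det N.+2 (fun j => K ^+ j *m phi x m)
     (fun j => (- K) ^+ j *m psi x m) /
     block_det N.+1 (fun j => K ^+ j *m phi x m)
       (fun j => (- K) ^+ j *m psi x m))
  (fun x m => dx (fun y k => block_det N.+1 (fun j => K ^+ j *m phi y k)
     (fun j => (- K) ^+ j *m psi y k)) x m /
     block_det N.+1 (fun j => K ^+ j *m phi x m)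
       (fun j => (- K) ^+ j *m psi x m)).
Proof.
rewrite (_ : (fun x m => 2 * _ / _) = fun x m => - 2 * q x m); last first.
  by apply/funext => x; apply/funext => m; rewrite -chiE.
rewrite (_ : (fun x m => dx _ _ _ / _) =
    fun x m => - \tr K - 2 * p x m); last first.
  by apply/funext => x; apply/funext => m; rewrite -varpiE.
move=> x m.
have dchi k : is_cderive (fun t => - 2 * q t k) x _ :=
  is_cderiveZ (- 2) (pq_dx x k).2.
have dvarpi : is_cderive (fun t => - \tr K - 2 * p t m) x _ :=
  is_cderiveD (is_cderive_cst (- \tr K) x)
    (is_cderiveN (is_cderiveZ 2 (pq_dx x m).1)).
split.
- exact: is_cderive_cderivable (dchi m).
- exact: is_cderive_cderivable dvarpi.
- have dxE k := is_cderive_cderive (dchi k).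
  rewrite [X in _ * (X - _)](dxE (m + 1)) [X in _ * (_ - X)](dxE m) /hat.
  have s_p k : (S x k)`_N = - \tr K - p x k by rewrite (trK x k); ring.
  have -> : (4 * kappa)%:C = 4 * kappa%:C by rewrite rmorphM rmorph_nat.
  exact: sine_gordon_field (shift_rel x m) (s_p m) (s_p (m + 1)).
(* Since [p_x = - 2 q r], the derivative of [varpi] is [4 q r]; the factor 4 is absorbed by the two
   factors [- 2] in [chi] and its conjugate. *)
- rewrite /dx (is_cderive_cderive dvarpi) conj_rel /scale_args.
  by rewrite rmorphM rmorphN rmorph_nat; ring.
Qed.

End Solution.

(** * Exponential waves in [x] and [m] *)

Section Waves.
Variables (R : realType) (n : nat).
Implicit Types (A B T : 'M[R[i]]_n) (V : R -> int -> 'cV[R[i]]_n).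

Lemma mulrz_mx A m : A *~ m = m%:~R *: A.
Proof. by rewrite scaler_int. Qed.

Lemma iter_dxv B V j :
  (forall x m, is_mxderive (V ^~ m) x (B *m V x m)) ->
  iter j (@dxv R n) V = fun x m => B ^+ j *m V x m.
Proof.
move=> dV; elim: j => [|j IH] /=; apply/funext => x; apply/funext => m.
  by rewrite expr0 mul1mx.
rewrite IH; apply/matrixP => i k; rewrite ord1 mxE.
rewrite (is_cderive_cderive (is_mxderiveMl (B ^+ j) (dV x m) i 0)).
by rewrite mulmxA exprSr.
Qed.

(** A common form for [phi], for its conjugate at the arguments scaled by [sigma], and for [psi],
    which differ only in the generators and the constant vector. *)
Definition wave A B (c : 'cV[R[i]]_n) (x : R) (m : int) :=
  expmx (A *~ m + x%:C *: B) *m c.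

Lemma comm_wave A B (x : R) (m : int) D : D *m A = A *m D -> D *m B = B *m D ->
  D *m (A *~ m + x%:C *: B) = (A *~ m + x%:C *: B) *m D.
Proof.
move=> DA DB; rewrite !mulrz_mx mulmxDr mulmxDl -!scalemxAr -!scalemxAl.
by rewrite DA DB.
Qed.

Lemma wave_dx A B c x m : A *m B = B *m A ->
  is_mxderive (fun t => wave A B c t m) x (B *m wave A B c x m).
Proof.
move=> AB.
have AmB t : (A *~ m) *m (t%:C *: B) = (t%:C *: B) *m (A *~ m).
  by rewrite !mulrz_mx -!scalemxAr -!scalemxAl AB !scalerA mulrC.
have dB := is_mxderiveMr c
  (is_mxderiveMl (expmx (A *~ m)) (is_mxderive_expmx B x)).
rewrite /wave (_ : (fun t => _) =
    fun t => expmx (A *~ m) *m expmx (t%:C *: B) *m c).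
  apply: is_mxderive_eq dB _.
  rewrite expmxD // !mulmxA; congr (_ *m _ *m _); apply: expmx_intertwine.
  by rewrite !mulrz_mx -!scalemxAr -!scalemxAl AB.
by apply/funext => t; rewrite expmxD.
Qed.

Lemma wave_shift A B c x m : A *m B = B *m A ->
  wave A B c x (m + 1) = expmx A *m wave A B c x m.
Proof.
move=> AB; rewrite /wave mulrzDr mulr1z [_ *~ _ + A]addrC -addrA expmxD.
  by rewrite mulmxA.
exact: comm_wave.
Qed.

Lemma conj_wave A B c x m :
  conjc_mx (wave A B c x m) = wave (conjc_mx A) (conjc_mx B) (conjc_mx c) x m.
Proof.
rewrite /wave /conjc_mx map_mxM -/(conjc_mx (expmx _)) conj_expmx /conjc_mx.
by rewrite map_mxD !mulrz_mx !map_mxZ rmorph_int /= oppr0.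
Qed.

Lemma wave_intertwine A B A' B' T c x m : T *m A' = A *m T ->
  T *m B' = B *m T -> T *m wave A' B' c x m = wave A B (T *m c) x m.
Proof.
move=> TA TB; rewrite /wave !mulmxA; congr (_ *m _); apply/esym.
apply: expmx_intertwine; rewrite !mulrz_mx mulmxDl mulmxDr.
by rewrite -!scalemxAl -!scalemxAr TA TB.
Qed.

Lemma invmx_intertwine A B T : A \in unitmx -> B \in unitmx ->
  A *m T = T *m B -> invmx A *m T = T *m invmx B.
Proof.
move=> Au Bu AT.
by rewrite -[LHS]mulmx1 -(mulmxV Bu) mulmxA -(mulmxA _ T) -AT mulKmx.
Qed.

End Waves.

(** * Transport of [Omega] and its hyperbolic cotangent through [T] *)

Section Intertwining.
Variables (R : realType) (n : nat) (sigma : int).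
Variables Omega T : 'M[R[i]]_n.
Hypothesis sigma_sign : sigma = 1 \/ sigma = -1.
Hypothesis Omega_unit : expmx (2 *: Omega) - 1%:M \in unitmx.
Hypothesis Omega_T : Omega *m T + sigma%:~R *: (T *m conjc_mx Omega) = 0.

Lemma cothmxK :
  cothmx Omega *m (expmx (2 *: Omega) - 1%:M) = expmx (2 *: Omega) + 1%:M.
Proof. by rewrite /cothmx mulmxKV. Qed.

Lemma cothmx_comm B : B *m Omega = Omega *m B ->
  B *m cothmx Omega = cothmx Omega *m B.
Proof.
move=> BO; have BX : B *m expmx (2 *: Omega) = expmx (2 *: Omega) *m B.
  by rewrite -(expmx_intertwine (A := 2 *: Omega)) // -scalemxAl -BO scalemxAr.
rewrite /cothmx mulmxA mulmxDr BX mulmx1 -[X in _ + X]mul1mx -mulmxDl -!mulmxA.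
congr (_ *m _); apply/esym/invmx_intertwine => //.
by rewrite mulmxBl mulmxBr mul1mx mulmx1 BX.
Qed.

Lemma T_conj_Omega : T *m conjc_mx Omega = - sigma%:~R *: Omega *m T.
Proof.
have ss : sigma%:~R * sigma%:~R = 1 :> R[i] by case: sigma_sign => ->; ring.
move/eqP: Omega_T; rewrite addr_eq0 => /eqP OT.
by rewrite -scalemxAl OT scalerN scaleNr opprK scalerA ss scale1r.
Qed.

Lemma T_conj_cothmx :
  T *m conjc_mx (cothmx Omega) = - sigma%:~R *: cothmx Omega *m T.
Proof.
set X := expmx (2 *: Omega); set c := cothmx Omega.
have conjX : conjc_mx X = expmx (2 *: conjc_mx Omega).
  by rewrite conj_expmx /conjc_mx map_mxZ rmorph_nat.
have TX : T *m conjc_mx X = expmx (- sigma%:~R *: (2 *: Omega)) *m T.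
  rewrite conjX; apply/esym/expmx_intertwine.
  by rewrite -scalemxAr T_conj_Omega -!scalemxAl !scalerA mulrC.
have Yu : conjc_mx (X - 1%:M) \in unitmx by rewrite map_unitmx.
(* Cancelling the conjugate of [X - 1] avoids handling the inverse inside [cothmx]. *)
apply: (can_inj (mulmxK Yu)); rewrite -mulmxA -[_ *m conjc_mx _]map_mxM cothmxK.
rewrite /conjc_mx map_mxD map_mxB map_mx1 -/(conjc_mx X).
rewrite -mulmxA mulmxDr mulmxBr mulmx1 TX.
have cE : c *m X = X + 1%:M + c.
  by apply/eqP; rewrite -subr_eq -[X in _ - X]mulmx1 -mulmxBr cothmxK.
(* For [sigma = 1] the claim is the oddness of the hyperbolic cotangent, shown with the inverse [Y]
   of [X]; for [sigma = -1] it is [cE] itself. *)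
case: sigma_sign => ->; rewrite ?mulrN1z ?opprK ?mulr1z ?scale1r ?scaleN1r.
  have XN := expmx_mulN (2 *: Omega); rewrite -/X in XN.
  set Y := expmx _ in XN *.
  have cY : c = (X + 1%:M + c) *m Y by rewrite -cE -mulmxA XN mulmx1.
  rewrite !mulmxDl XN mul1mx in cY.
  have cYB : c *m Y - c = - (1%:M + Y).
    by rewrite {2}cY opprD addrCA subrr addr0.
  rewrite mulNmx mulmxBr mulmxA -mulmxBl cYB mulNmx opprK mulmxDl mul1mx.
  by rewrite addrC.
by rewrite mulmxBr mulmxA cE !mulmxDl mul1mx addrK.
Qed.

End Intertwining.

(** The dimension is a variable tied to [2 * N.+1] by an equation, so that it can be replaced by a
    successor, the form in which the polynomial calculus is stated. *)
Lemma wronskian_sine_gordon (R : realType) (eta sigma : int) (n N : nat)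
  (delta : R) (Omega T : 'M[R[i]]_n) (C : 'cV[R[i]]_n)
  (n_def : n = (2 * N.+1)%N)
  (sigma_sign : sigma = 1 \/ sigma = -1)
  (Omega_unit : expmx (2 *: Omega) - 1%:M \in unitmx)
  (Omega_T : Omega *m T + sigma%:~R *: (T *m conjc_mx Omega) = 0)
  (T_conj : T *m conjc_mx T = (- (sigma * eta)%:~R)%:M) :
  let f x m := block_det N.+1 (phi_col delta Omega C x m)
                              (Tphi_col sigma delta Omega T C x m) in
  (forall (x : R) (m : int), f x m != 0) ->
  semidiscrete_sine_gordon eta sigma delta
    (fun x m => 2 * block_det N.+2 (phi_col delta Omega C x m)
                              (Tphi_col sigma delta Omega T C x m) / f x m)
    (fun x m => dx f x m / f x m).
Proof.
case: n n_def Omega T C Omega_unit Omega_T T_conj => [|n] n_def Omega T C.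
  by rewrite mul2n in n_def.
move=> Omega_unit Omega_T T_conj.
pose kappa := delta / 4; pose K := kappa%:C *: cothmx Omega.
have OO : Omega *m Omega = Omega *m Omega by [].
have OK : Omega *m K = K *m Omega.
  by rewrite -scalemxAr -scalemxAl cothmx_comm.
(* Both signs give these generators: the [sigma] of the scaled arguments meets the [- sigma]
   produced by passing [T] across the conjugates of [Omega] and [K]. *)
pose psi x m := wave (- Omega) (- K) (T *m conjc_mx C) x m.
have phiE x m : phi_sol delta Omega C x m = wave Omega K C x m.
  by rewrite /phi_sol /wave scalerA -rmorphM /= mulrC -/kappa.
have NN : - Omega *m - K = - K *m - Omega by rewrite !mulNmx !mulmxN OK.
have phi_dx x m : is_mxderive (phi_sol delta Omega C ^~ m) x
    (K *m phi_sol delta Omega C x m).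
  rewrite (_ : _ ^~ m = fun t => wave Omega K C t m).
    by rewrite phiE; apply: wave_dx.
  by apply/funext => t; rewrite phiE.
have psi_dx x m : is_mxderive (psi ^~ m) x (- K *m psi x m) by apply: wave_dx.
have TO := T_conj_Omega sigma_sign Omega_T.
have TK : T *m conjc_mx K = - sigma%:~R *: K *m T.
  have Tc := T_conj_cothmx sigma_sign Omega_unit Omega_T.
  have -> : conjc_mx K = kappa%:C *: conjc_mx (cothmx Omega).
    by rewrite [LHS]map_mxZ; congr (_ *: _); apply: conjc_real.
  by rewrite -scalemxAr Tc -!scalemxAl !scalerA mulrC.
have sigma_sq : sigma * sigma = 1 by case: sigma_sign => ->.
have sigmaC : sigma%:~R * sigma%:~R = 1 :> R[i] by rewrite -intrM sigma_sq.
pose Oc := sigma%:~R *: conjc_mx Omega; pose Kc := sigma%:~R *: conjc_mx K.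
have TOc : T *m Oc = - Omega *m T.
  by rewrite -scalemxAr TO -scalemxAl scalerA mulrN sigmaC scaleN1r mulNmx.
have TKc : T *m Kc = - K *m T.
  by rewrite -scalemxAr TK -scalemxAl scalerA mulrN sigmaC scaleN1r mulNmx.
have conj_phiE x m :
    conjc_mx (phi_sol delta Omega C (sigma%:~R * x) (sigma * m)) =
    wave Oc Kc (conjc_mx C) x m.
  rewrite phiE conj_wave /wave /Oc /Kc !mulrz_mx !scalerA intrM mulrC.
  by rewrite rmorphM /= rmorph_int [x%:C * _]mulrC.
have psiE x m : psi x m =
    T *m conjc_mx (phi_sol delta Omega C (sigma%:~R * x) (sigma * m)).
  by rewrite conj_phiE (wave_intertwine _ _ _ TOc TKc).
have phi_colE : phi_col delta Omega C =
    fun x m j => K ^+ j *m phi_sol delta Omega C x m.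
  apply/funext => x; apply/funext => m; apply/funext => j.
  by rewrite /phi_col (iter_dxv _ phi_dx).
have Tphi_colE : Tphi_col sigma delta Omega T C =
    fun x m j => (- K) ^+ j *m psi x m.
  apply/funext => x; apply/funext => m; apply/funext => j; rewrite /Tphi_col.
  rewrite (_ : (fun y k => _) = wave Oc Kc (conjc_mx C)); last first.
    by apply/funext => y; apply/funext => k; rewrite /scale_args conj_phiE.
  have OKc : Oc *m Kc = Kc *m Oc.
    rewrite -!scalemxAl -!scalemxAr /conjc_mx -!map_mxM OK.
    by rewrite !scalerA mulrC.
  rewrite (iter_dxv _ (fun y k => wave_dx _ _ _ OKc)) psiE conj_phiE.
  by rewrite (mulmxA T) -(exp_intertwine _ (esym TKc)) -(mulmxA _ T).
rewrite phi_colE Tphi_colE => f f_neq0.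
have deltaE : delta = 4 * kappa by rewrite /kappa mulrC divfK // pnatr_eq0.
have X_U : expmx Omega *m expmx Omega = expmx (2 *: Omega).
  have -> : 2 *: Omega = Omega + Omega by rewrite scaler_nat mulr2n.
  exact/esym/expmxD.
(* This is [K (X - 1) = kappa (X + 1)] with [X = expmx (2 *: Omega)], rearranged. *)
have KU : (K - kappa%:C%:M) *m (expmx Omega *m expmx Omega) = K + kappa%:C%:M.
  rewrite X_U; have := cothmxK Omega_unit; rewrite mulmxBr mulmx1.
  move/(congr1 (fun Z => kappa%:C *: Z)); rewrite scalerBr scalemxAl -/K => /eqP.
  rewrite subr_eq scalerDr scale_scalar_mx mulr1 => /eqP KX.
  rewrite mulmxBl KX mul_scalar_mx -[X in X - _]addrA.
  by rewrite [X in X - _]addrC addrK addrC.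
have phi_shift x m : phi_sol delta Omega C x (m + 1) =
    expmx Omega *m phi_sol delta Omega C x m by rewrite !phiE wave_shift.
have psi_shift x m : expmx Omega *m psi x (m + 1) = psi x m.
  by rewrite /psi wave_shift // mulmxA expmx_mulN mul1mx.
have UK : expmx Omega *m K = K *m expmx Omega by apply: expmx_intertwine.
have W_unit x m :
    wronskmx N K (phi_sol delta Omega C x m) (psi x m) \in unitmx.
  by rewrite unitmxE unitfE; apply: f_neq0.
rewrite [X in semidiscrete_sine_gordon _ _ X]deltaE.
exact: (wronskian_solution n_def sigma_sign phi_dx psi_dx phi_shift
  psi_shift UK KU TK psiE T_conj W_unit).
Qed.

Theorem theorem10 (R : realType) (eta sigma : int) (N : nat) (delta : R)
  (Omega T : 'M[R[i]]_(2 * N.+1)) (C : 'cV[R[i]]_(2 * N.+1))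
  (eta_sign : eta = 1 \/ eta = -1) (sigma_sign : sigma = 1 \/ sigma = -1)
  (Omega_unit : expmx (2 *: Omega) - 1%:M \in unitmx)
  (Omega_T : Omega *m T + sigma%:~R *: (T *m conjc_mx Omega) = 0)
  (T_conj : T *m conjc_mx T = (- (sigma * eta)%:~R)%:M)
  (f_neq0 : forall (x : R) (m : int), f_sol sigma delta Omega T C x m != 0) :
  semidiscrete_sine_gordon eta sigma delta
    (fun x m => g_sol sigma delta Omega T C x m / f_sol sigma delta Omega T C x m)
    (fun x m => dx (f_sol sigma delta Omega T C) x m
                / f_sol sigma delta Omega T C x m).
Proof. by apply: wronskian_sine_gordon f_neq0. Qed.
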